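(* Let $G$ be a semigroupoid, let $\Psi$ be a collection of test functions for $G$, let $\mathfrak B=C_b(\Psi)$ and let $E:G\to\mathfrak B$ be the evaluation $E(x)(\psi)=\psi(x)$. Let $F\subset G$ be a finite lower set and suppose $f\in P(F)$, i.e. $f:F\to\mathbb C$. The following are equivalent: (i) there exists $\varphi\in H^\infty(\mathcal K_\Psi)$ such that $\|\varphi\|_{H^\infty(\mathcal K_\Psi)}\le1$ and $\varphi|_F=f$; (ii) for each $\mathbf k\in\mathcal K_\Psi$, the kernel $$F\times F\ni(x,y)\mapsto(([1]-ff^* )\star\mathbf k)(x,y)$$ is positive; (iii) there is a positive kernel $\Gamma:F\times F\to\mathfrak B^*$ such that for all $x,y\in F$ $$([1]-ff^* )(x,y)=(\Gamma\,\hat\star\,([1]-EE^* ))(x,y).$$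
   Context: **Semigroupoids.** Let $G$ be a set with a partial multiplication, i.e. a map $X\to G$, $(x,y)\mapsto xy$, with $X\subset G\times G$; ''$xy$ is defined'' means $(x,y)\in X$. An element $e\in G$ is idempotent if $ex=x$ whenever $ex$ is defined and $ye=y$ whenever $ye$ is defined. $G$ is a semigroupoid if: (1) if either $(ab)c$ or $a(bc)$ is defined then so is the other and they are equal; and if $ab$ and $bc$ are defined then so is $(ab)c$; (2) for each $a\in G$ there exist idempotents $e,f\in G$ with $ea=a=af$, and any $e\in G$ with $e^2=e$ is idempotent; (3) if $ab=e$ with $e$ idempotent then $a=b=e$; (4) for each $a\in G$ the set of triples $(z,b,w)$ with $zbw=a$ is finite, and there is $N<\infty$ with $\mathrm{card}\{b\in G: cb=a\}\le N$ for all $a,c\in G$. $G_e$ denotes the set of idempotents. Write $b\le a$ if $a=zbw$ for some $z,w\in G$; this is a partial order. $F\subset G$ is lower if $a\in F$, $b\le a$ imply $b\in F$; $F_e=F\cap G_e$. **Products.** For functions $f,g$ on a lower set $F$, $(f\star g)(a)=\sum_{rs=a}f(r)g(s)$. $P(F)$ is the algebra of functions $F\to\mathbb C$ with this product; its unit is $\delta(x)=1$ for $x\in F_e$, $\delta(x)=0$ otherwise. For $A,B:F\times F\to\mathbb C$, $(A\star B)(a,b)=\sum_{pq=a}\sum_{rs=b}A(p,r)B(q,s)$ (since $F$ is lower, all indices lie in $F$ when $a,b\in F$; kernels on $G$ are restricted to $F\times F$). $[1](x,y)=1$ if $x,y$ are both idempotent, and $0$ otherwise. For a function $f$, $ff^*$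 denotes $(x,y)\mapsto f(x)f(y)^*$. **Test functions.** For a finite lower set $F$ and $\varphi:F\to\mathbb C$, the Toeplitz matrix $\mathfrak T(\varphi)$ is the operator on the Hilbert space $\mathbb C^F$ (standard inner product) with entries $[\mathfrak T(\varphi)]_{a,b}=\sum_{c:\,cb=a}\varphi(c)$. A nonempty collection $\Psi$ of functions $G\to\mathbb C$ is a collection of test functions if (i) $\|\mathfrak T(\psi|_F)\|\le1$ for each finite lower set $F$ and $\psi\in\Psi$; (ii) for each $a\in G_e$, $\lim_{n\to\infty}\psi(a)^n=0$ uniformly in $\psi\in\Psi$; (iii) for each finite lower set $F$ the (unital) algebra generated by $\{\psi|_F:\psi\in\Psi\}$ is all of $P(F)$. **Kernels.** A function $\mathbf k:F\times F\to\mathbb C$ is a positive kernel if $(\mathbf k(a,b))_{a,b\in A}$ is positive semidefinite for each finite $A\subset F$. $\mathcal K_\Psi$ is the set of positive kernels $\mathbf k$ on $G$ such that $([1]-\psi\psi^* )\star\mathbf k$ is a positive kernel for each $\psi\in\Psi$. $H^\infty(\mathcal K_\Psi)$ is the set of $\varphi:G\to\mathbb C$ for which there is $C>0$ such that $(C^2[1]-\varphi\varphi^* )\star\mathbf k$ is a positive kernel on $G$ for every $\mathbf k\in\mathcal K_\Psi$; $\|\varphi\|_{H^\infty(\mathcal K_\Psi)}$ is the infimum of such $C$. **The algebra $\mathfrak B$.** $\Psi$ carries the topology of pointwise convergence on $G$, in which it is assumed compact; $\mathfrak B=C_b(\Psi)$ is the $C^*$-algebra of bounded continuous functions on $\Psi$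 with the sup norm, $\mathfrak B^*$ its Banach space dual, and $E(x)\in\mathfrak B$ is $E(x)(\psi)=\psi(x)$. A function $\Gamma:F\times F\to\mathfrak B^*$ is a positive kernel if for each finite $A\subset F$ and $f:A\to\mathfrak B$, $\sum_{x,y\in A}\Gamma(x,y)(f(x)f(y)^* )\ge0$. For such $\Gamma$, $$(\Gamma\,\hat\star\,([1]-EE^* ))(x,y)=\sum_{pq=x}\sum_{rs=y}\Gamma(q,s)\big([1](p,r)1-E(p)E(r)^*\big).$$ *)

(* Defs.v *)
From HB Require Import structures.
From mathcomp Require Import all_boot all_order all_algebra finmap.
From mathcomp Require Import all_classical all_reals all_analysis.
From mathcomp Require Export complex.

Set Implicit Arguments.
Unset Strict Implicit.
Unset Printing Implicit Defensive.

Import Order.TTheory GRing.Theory Num.Theory.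
Import numFieldNormedType.Exports.
Local Open Scope classical_set_scope.
Local Open Scope ring_scope.

(* R[i] carries the topology and norm that every numFieldType has on its
   regular module; mathcomp-analysis does not declare this for [complex]. *)
HB.instance Definition _ (R : realType) := NormedModule.copy R[i] R[i]^o.

(* [m x y = Some z] : xy is defined and equals z; [None] : xy is undefined. *)
Definition pmul (T : Type) := T -> T -> option T.

Section Semigroupoid.
Variables (G : choiceType) (m : pmul G).

Definition idem (e : G) : Prop :=
  (forall x z, m e x = Some z -> z = x) /\
  (forall y z, m y e = Some z -> z = y).

(* (ab)c and a(bc), undefined as soon as one of the products involved is *)
Definition mul3l (a b c : G) : option G := obind (fun ab => m ab c) (m a b).
Definition mul3r (a b c : G) : option G := obind (fun bc => m a bc) (m b c).

Record semigroupoid : Prop := Semigroupoid {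
  sg_assoc : forall a b c, mul3l a b c = mul3r a b c;
  sg_defined : forall a b c, m a b -> m b c -> mul3l a b c;
  sg_unit : forall a, exists e f,
    [/\ idem e, idem f, m e a = Some a & m a f = Some a];
  sg_idem : forall e, m e e = Some e -> idem e;
  sg_factor_idem : forall a b e, idem e -> m a b = Some e -> a = e /\ b = e;
  sg_finite : forall a,
    finite_set [set t : G * G * G | mul3l t.1.1 t.1.2 t.2 = Some a];
  sg_card : exists N : nat, forall a c,
    ([set b | m c b = Some a] #<= `I_N)%card }.

Definition sg_le (b a : G) : Prop := exists z w, mul3l z b w = Some a.

Definition lower (F : set G) : Prop :=
  forall a b, F a -> sg_le b a -> F b.

(* The multiplication inherited by F. For F lower, all factors of an element
   of F lie in F, so no factorization is lost. *)
Definition resm (F : {fset G}) : pmul F :=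
  fun x y => obind insub (m (val x) (val y)).

Lemma resmP (F : {fset G}) (x y z : F) :
  resm x y = Some z <-> m (val x) (val y) = Some (val z).
Proof.
rewrite /resm; case: (m _ _) => [t|] /=; last by split.
case: insubP => [u _ <-|tF]; first by split=> [[->]|[/val_inj ->]].
by split=> // -[tz]; move: tF; rewrite tz (valP z).
Qed.

End Semigroupoid.
Arguments resm {G} m F x y.

Section Convolution.
Variables (R : realType) (T : choiceType) (m : pmul T).
Local Notation C := R[i].

(* \sum_(p \in A) is 0 when the support in A is infinite; in a semigroupoid
   [factor a] is finite, so these are genuine sums. *)
Definition factor (a : T) : set (T * T) := [set p | m p.1 p.2 = Some a].

Definition star (f g : T -> C) : T -> C :=
  fun a => \sum_(p \in factor a) f p.1 * g p.2.

Definition kstar (A B : T -> T -> C) : T -> T -> C :=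
  fun a b => \sum_(p \in factor a) \sum_(r \in factor b)
    A p.1 r.1 * B p.2 r.2.

End Convolution.

Section Kernels.
Variable R : realType.
Local Notation C := R[i].

Definition psd (I : finType) (M : I -> I -> C) : Prop :=
  forall c : I -> C, 0 <= \sum_i \sum_j (c i)^* * M i j * c j.

Definition pos_kernel (T : choiceType) (k : T -> T -> C) : Prop :=
  forall A : {fset T}, psd (fun a b : A => k (val a) (val b)).

Definition kres (G : choiceType) (F : {fset G}) (k : G -> G -> C) :
    F -> F -> C :=
  fun x y => k (val x) (val y).

Definition kone (G : choiceType) (m : pmul G) (x y : G) : C :=
  `[< idem m x /\ idem m y >]%:R.

Definition outer (T : Type) (f : T -> C) (x y : T) : C := f x * (f y)^*.

End Kernels.

Section OperatorNorm.
Variable R : realType.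
Local Notation C := R[i].

(* The norm of R[i] takes its (real) values in R[i]. *)
Definition l2norm (I : finType) (v : I -> C) : R :=
  Num.sqrt (\sum_i complex.Re `|v i| ^+ 2).

Definition mxapply (I : finType) (M : I -> I -> C) (v : I -> C) : I -> C :=
  fun a => \sum_b M a b * v b.

Definition opnorm (I : finType) (M : I -> I -> C) : R :=
  sup [set l2norm (mxapply M v) | v in [set v | l2norm v <= 1]].

Definition toeplitz (I : finType) (m : pmul I) (phi : I -> C) : I -> I -> C :=
  fun a b => \sum_(c | m c b == Some a) phi c.

End OperatorNorm.

Section TestFunctions.
Variables (R : realType) (G : choiceType) (m : pmul G).
Local Notation C := R[i].

Definition fres (F : {fset G}) (phi : G -> C) : F -> C := phi \o val.

Definition delta (F : {fset G}) : F -> C := fun x => `[< idem m (val x) >]%:R.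

Inductive gen_alg (F : {fset G}) (S : set (F -> C)) : set (F -> C) :=
| gen_base f : S f -> gen_alg S f
| gen_unit : gen_alg S (@delta F)
| gen_add f g : gen_alg S f -> gen_alg S g -> gen_alg S (f + g)
| gen_scale (c : C) f : gen_alg S f -> gen_alg S (c *: f)
| gen_star f g :
    gen_alg S f -> gen_alg S g -> gen_alg S (star (resm m F) f g).

Record test_functions (Psi : set {ptws G -> C}) : Prop := TestFunctions {
  tf_nonempty : Psi !=set0;
  tf_contractive : forall F : {fset G}, lower m [set` F] ->
    forall psi, Psi psi ->
    opnorm (toeplitz (resm m F) (fres psi)) <= 1;
  tf_idem : forall a, idem m a ->
    {uniform Psi, (fun (n : nat) (psi : {ptws G -> C}) => psi a ^+ n)
                    @ \oo --> (fun=> 0)};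
  tf_generate : forall F : {fset G}, lower m [set` F] ->
    gen_alg [set fres (F := F) psi | psi in Psi] = [set: F -> C] }.

Definition K_Psi (Psi : set {ptws G -> C}) : set (G -> G -> C) :=
  [set k | pos_kernel k /\ forall psi, Psi psi ->
    pos_kernel (kstar m (fun x y => kone R m x y - outer psi x y) k)].

Definition Hinf_bound (Psi : set {ptws G -> C}) (phi : G -> C) : set R :=
  [set c | 0 < c /\ forall k, K_Psi Psi k ->
    pos_kernel (kstar m
      (fun x y => (c ^+ 2)%:C%C * kone R m x y - outer phi x y) k)].

Definition Hinf (Psi : set {ptws G -> C}) : set (G -> C) :=
  [set phi | Hinf_bound Psi phi !=set0].

Definition Hinf_norm (Psi : set {ptws G -> C}) (phi : G -> C) : R :=
  inf (Hinf_bound Psi phi).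

End TestFunctions.

Section Cb.
Variables (R : realType) (X : topologicalType).
Local Notation C := R[i].

Definition Cb_pred : {pred X -> C} :=
  fun f => `[< continuous f /\ bounded_fun f >].

Record Cb : Type := MkCb { Cb_val :> X -> C; Cb_valP : Cb_val \in Cb_pred }.

HB.instance Definition _ := [isSub for Cb_val].
HB.instance Definition _ := [Choice of Cb by <:].

Lemma Cb_predP (f : X -> C) :
  f \in Cb_pred <-> continuous f /\ exists M : C, forall x, `|f x| <= M.
Proof.
split=> [/asboolP[cf bf]|[cf [M fM]]].
  split=> //; have [M [Mr fM]] := bf.
  exists (M + 1) => x; apply: fM => //.
  by rewrite ltrDl ltr01.
apply/asboolP; split=> //; exists (`|M|); split; first exact: normr_real.
move=> N MN x _; apply: le_trans (fM x) _.
have M0 : 0 <= M := le_trans (normr_ge0 _) (fM x).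
by rewrite -(ger0_norm M0) ltW.
Qed.

Lemma Cb_subring_closed : subring_closed Cb_pred.
Proof.
split.
- apply/Cb_predP; split; first by move=> x; exact: cvg_cst.
  by exists 1 => x; rewrite normr1.
- move=> f g /Cb_predP[cf [M fM]] /Cb_predP[cg [N gN]].
  apply/Cb_predP; split.
    by move=> x; apply: cvgB; [exact: cf|exact: cg].
  exists (M + N) => x; apply: le_trans (ler_normB _ _) _.
  exact: lerD.
- move=> f g /Cb_predP[cf [M fM]] /Cb_predP[cg [N gN]].
  apply/Cb_predP; split.
    by move=> x; apply: (@cvgM R[i]); [exact: cf|exact: cg].
  exists (M * N) => x; rewrite normrM.
  exact: ler_pM.
Qed.

HB.instance Definition _ :=
  GRing.isSubringClosed.Build (X -> C) Cb_pred Cb_subring_closed.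
HB.instance Definition _ :=
  GRing.SubChoice_isSubComPzRing.Build (X -> C) Cb_pred Cb (subringClosedP _).

Lemma Cb_scaler_closed : scaler_closed Cb_pred.
Proof.
move=> c f /Cb_predP[cf [M fM]]; apply/Cb_predP; split.
  by move=> x; apply: (@cvgM R[i]); [exact: cvg_cst|exact: cf].
exists (`|c| * M) => x; rewrite normrM.
exact: ler_wpM2l.
Qed.

HB.instance Definition _ :=
  GRing.isScaleClosed.Build C (X -> C) Cb_pred Cb_scaler_closed.
HB.instance Definition _ := [SubZmodule_isSubLmodule of Cb by <:].

Lemma Cb_conj_subproof (f : Cb) : (fun x => (f x)^*) \in Cb_pred.
Proof.
have /Cb_predP[cf [M fM]] := Cb_valP f.
apply/Cb_predP; split; last by exists M => x; rewrite norm_conjC.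
move=> x; apply/cvgrPdist_lt => e e0.
have /cvgrPdist_lt /(_ e e0) := cf x.
by apply: filterS => y; rewrite -rmorphB norm_conjC.
Qed.

Definition Cb_conj (f : Cb) : Cb := MkCb (Cb_conj_subproof f).

Definition sup_norm (f : Cb) : R := sup (range (fun x => complex.Re `|f x|)).

Lemma ReK_norm (z : C) : (complex.Re `|z|)%:C%C = `|z|.
Proof. by case: z. Qed.

Lemma le_sup_norm (f : Cb) x : `|f x| <= (sup_norm f)%:C%C.
Proof.
rewrite -ReK_norm lecR; apply: ub_le_sup; last by exists x.
have /Cb_predP[_ [M fM]] := Cb_valP f.
exists (complex.Re M) => _ [y _ <-].
by have := fM y; rewrite lecE => /andP[].
Qed.

Lemma sup_norm_le (f : Cb) (M : R) :
  0 <= M -> (forall x, `|f x| <= M%:C%C) -> sup_norm f <= M.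
Proof.
move=> M0 fM; rewrite /sup_norm.
have [->|ne] := eqVneq (range (fun x => complex.Re `|f x|)) set0.
  by rewrite sup0.
apply: ge_sup; first exact/set0P.
by move=> _ [x _ <-]; rewrite -lecR ReK_norm.
Qed.

Lemma sup_norm_ge0 (f : Cb) : 0 <= sup_norm f.
Proof.
rewrite /sup_norm.
have [->|/set0P[_ [x _ _]]] := eqVneq (range (fun x => complex.Re `|f x|)) set0.
  by rewrite sup0.
by rewrite -ler0c; apply: le_trans (le_sup_norm f x).
Qed.

Lemma sup_normD (f g : Cb) :
  (sup_norm (f + g))%:C%C <= (sup_norm f)%:C%C + (sup_norm g)%:C%C :> C.
Proof.
rewrite -rmorphD lecR; apply: sup_norm_le; first by rewrite addr_ge0 ?sup_norm_ge0.
move=> x; rewrite rmorphD; apply: le_trans (ler_normD _ _) _.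
by apply: lerD; exact: le_sup_norm.
Qed.

Lemma sup_normZ (c : C) (f : Cb) :
  (sup_norm (c *: f))%:C%C = `|c| * (sup_norm f)%:C%C :> C.
Proof.
have le1 (d : C) (g : Cb) : sup_norm (d *: g) <= complex.Re `|d| * sup_norm g.
  apply: sup_norm_le; first by rewrite mulr_ge0 ?sup_norm_ge0 // -ler0c ReK_norm.
  move=> x; rewrite rmorphM /= [X in X * _]ReK_norm.
  rewrite normrM; apply: ler_wpM2l => //; exact: le_sup_norm.
rewrite -ReK_norm -rmorphM; congr (_%:C%C); apply/eqP; rewrite eq_le le1 andTb.
have [->|c0] := eqVneq c 0.
  by rewrite normr0 mul0r sup_norm_ge0.
have := le1 c^-1 (c *: f); rewrite scalerA mulVf // scale1r => h.
rewrite -lecR rmorphM /= [X in X * _]ReK_norm -ler_pdivlMl ?normr_gt0 //.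
by move: h; rewrite -lecR rmorphM /= [X in X * _]ReK_norm normfV.
Qed.

Lemma sup_norm_eq0 (f : Cb) : (sup_norm f)%:C%C = 0 :> C -> f = 0.
Proof.
move=> f0; apply/val_inj/funext => x /=.
by apply/eqP; rewrite -normr_le0 -f0 le_sup_norm.
Qed.

HB.instance Definition _ :=
  Lmodule_isNormed.Build C Cb sup_normD sup_normZ sup_norm_eq0.

End Cb.

Record banach_dual (R : realType) (V : normedModType R[i]) : Type :=
  BanachDual {
  dual_fun :> {linear V -> R[i]};
  dual_continuous : continuous dual_fun }.

Section Evaluation.
Variables (R : realType) (G : choiceType) (Psi : set {ptws G -> R[i]}).
Local Notation C := R[i].

Lemma eval_continuous (x : G) : continuous (fun psi : Psi => val psi x : C).
Proof.
move=> psi.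
apply: (@continuous_comp _ _ _ (set_val : Psi -> {ptws G -> C})
  (fun phi : {ptws G -> C} => phi x)).
  exact: initial_continuous.
exact: (@proj_continuous G (fun=> C) x).
Qed.

Lemma Re_norm_continuous : continuous (fun z : C => complex.Re `|z| : R).
Proof.
move=> z; have FF : Filter (nbhs (z : C)) by exact: nbhs_filter.
apply: (proj2 (cvgrPdist_lt (F := nbhs (z : C)) _ _)) => e e0.
have e0' : 0 < e%:C%C :> C by rewrite (ltcR 0 e).
apply: filterS (nbhsx_ballx (z : C^o) _ e0') => w.
rewrite -ball_normE /= => zw.
rewrite -ltcR; apply: le_lt_trans zw.
apply: le_trans (ler_dist_dist z w).
rewrite -(ReK_norm z) -(ReK_norm w) -rmorphB lecE /= eqxx /=.
by rewrite expr0n /= addr0 sqrtr_sqr.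
Qed.

Lemma eval_subproof (cPsi : compact Psi) (x : G) :
  (fun psi : Psi => val psi x : C) \in @Cb_pred R Psi.
Proof.
apply/Cb_predP; split; first exact: eval_continuous.
have cN : continuous (fun phi : {ptws G -> C} => complex.Re `|phi x| : R).
  move=> phi.
  apply: (@continuous_comp _ _ _ (fun phi : {ptws G -> C} => phi x : C)).
    exact: (@proj_continuous G (fun=> C) x).
  exact: Re_norm_continuous.
have [M [Mr NM]] := compact_bounded (continuous_compact
  (continuous_subspaceT cN) cPsi).
exists (M + 1)%:C%C => psi.
rewrite -ReK_norm lecR.
apply: le_trans (ler_norm _) _.
apply: (NM (M + 1)); first by rewrite ltrDl.
by exists (val psi) => //; exact: set_valP.
Qed.

Definition Cb_eval (cPsi : compact Psi) (x : G) : Cb R Psi :=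
  MkCb (eval_subproof cPsi x).

End Evaluation.

Section DualKernels.
Variables (R : realType) (X : topologicalType).
Local Notation C := R[i].
Local Notation B := (Cb R X).

Definition pos_dual_kernel (T : choiceType) (Gam : T -> T -> banach_dual B) :
    Prop :=
  forall (A : {fset T}) (g : A -> B),
    0 <= \sum_(x : A) \sum_(y : A) Gam (val x) (val y) (g x * Cb_conj (g y)).

Definition hatstar (G : choiceType) (m : pmul G) (F : {fset G})
    (E : G -> B) (Gam : F -> F -> banach_dual B) : F -> F -> C :=
  fun x y => \sum_(p \in factor (resm m F) x)
    \sum_(r \in factor (resm m F) y)
      Gam p.2 r.2 (kone R m (val p.1) (val r.1) *: (1 : B)
                   - E (val p.1) * Cb_conj (E (val r.1))).

End DualKernels.

(* Main.v *)
Require Import Defs.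
From HB Require Import structures.
From mathcomp Require Import all_boot all_order all_algebra finmap.
From mathcomp Require Import all_classical all_reals all_analysis.
From mathcomp Require Import ring lra.
Set Implicit Arguments.
Unset Strict Implicit.
Unset Printing Implicit Defensive.
Import Order.TTheory GRing.Theory Num.Theory.
Import numFieldNormedType.Exports.
Local Open Scope classical_set_scope.
Local Open Scope ring_scope.

(* Write T_g for the Toeplitz operator of g on C^F, so that (g g^* ) * k is the
   matrix T_g k T_g^*.  For positive definite k with inverse L, the conditions
   k >= T_g k T_g^* and L >= T_g^* L T_g are equivalent.
   (ii) => (iii).  The kernels sum_i (h_i h_i^* - (psi_i * h_i)(psi_i * h_i)^* )
   form a closed cone: Caratheodory's theorem bounds the number of terms, Psi is
   compact, and the h_i stay bounded because every psi is uniformly less than 1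
   in modulus on idempotents.  If Y is the difference between the point of the
   cone nearest to [1] - f f^* and [1] - f f^*, then Y >= T_psi^* Y T_psi for all
   psi, hence Y >= 0; the inverse of Y + eps, continued by 1/eps off F, belongs
   to K_Psi, so (ii) gives Y >= T_f^* Y T_f.  Evaluated at the unit of P(F) this
   says <Y, [1] - f f^*> >= 0, which forces Y = 0.
   (iii) => (ii).  Passing to L, one pairs Gamma with the C_b(Psi)-valued matrix
   L - T_psi^* L T_psi, which is pointwise positive; a Cholesky factorisation
   over C_b(Psi) shows that the pairing is nonnegative.
   (ii) => (i).  A finite sum as above is a Gram identity; a unitary realising
   it defines a transfer function on G, which extends f and yields the same
   identity on every finite lower set. *)

(** * Semigroupoids *)

(** The estimates rest on one fact: with F ordered by [rank], all T_psi are triangular with values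
    of psi at idempotents on the diagonal, so a single diagonal weight makes them contract by a
    common factor rho < 1. This drives both the bound on the h_i and the passage from Y >= T_psi^* Y
    T_psi to Y >= 0. The triangular shape also lets the transfer function be computed by recursion
    on [rank]. An inequality at the unit alone is weaker than one at all vectors. For the nearest
    point it suffices, since Y is only tested against [1] - f f^*; in (iii) => (ii), right
    convolutions, which commute with Toeplitz operators, carry the unit to every vector. A general
    Gamma may call for an infinite-dimensional unitary. For (iii) => (i) it is therefore exchanged,
    by way of (ii), for a finite sum of point evaluations, so that U stays a finite matrix. *)

Section PartialMul.
Variables (T : choiceType) (m : pmul T).
Hypothesis mA : forall a b c, mul3l m a b c = mul3r m a b c.

Lemma pmul_assocl a b ab c x : m a b = Some ab -> m ab c = Some x ->
  exists2 bc, m b c = Some bc & m a bc = Some x.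
Proof.
move=> ab_ x_; have : mul3l m a b c = Some x by rewrite /mul3l ab_.
by rewrite mA /mul3r; case: (m b c) => //= bc; exists bc.
Qed.

Lemma pmul_assocr a b c bc x : m b c = Some bc -> m a bc = Some x ->
  exists2 ab, m a b = Some ab & m ab c = Some x.
Proof.
move=> bc_ x_; have : mul3r m a b c = Some x by rewrite /mul3r bc_.
by rewrite -mA /mul3l; case: (m a b) => //= ab; exists ab.
Qed.

End PartialMul.

Section SemigroupoidTheory.
Variables (G : choiceType) (m : pmul G) (Gsg : semigroupoid m).
Local Notation mA := (sg_assoc Gsg).

Lemma idem_factors e p q : idem m e -> m p q = Some e -> p = e /\ q = e.
Proof. exact: sg_factor_idem. Qed.

Lemma finite_left_stab a : finite_set [set p | m p a = Some a].
Proof.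
have [e [f [_ _ _ af]]] := sg_unit Gsg a.
apply: (@sub_finite_set _ _ ((fun t : G * G * G => t.1.1) @`
  [set t : G * G * G | mul3l m t.1.1 t.1.2 t.2 = Some a])); last first.
  exact/finite_image/(sg_finite Gsg).
by move=> p /= pa; exists (p, a, f) => //=; rewrite /mul3l pa.
Qed.

(* Two powers of p coincide because the left stabiliser of a is finite; a
   suitable power is then idempotent, hence so is its factor p. *)
Lemma left_stab_idem a p : m p a = Some a -> idem m p.
Proof.
(* [pw n] is p^(n+1), hence the successor in [pwD]; the default of [odflt] is never reached, because
   p fixes a. *)
move=> pa; pose pw n := iter n (fun x => odflt p (m p x)) p.
have pwS n : m p (pw n) = Some (pw n.+1) /\ m (pw n) a = Some a.
  elim: n => [|n [IH1 IH2]].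
    by have [pp pp_ _] := pmul_assocr mA pa pa; rewrite /pw /= pp_.
  have [y y_ ya] := pmul_assocr mA IH2 pa.
  move: y_; rewrite IH1 => -[?]; subst y.
  by have [z z_ _] := pmul_assocr mA ya pa; split; rewrite // [pw n.+2]/= z_.
have pwD i j : m (pw i) (pw j) = Some (pw (i + j).+1).
  elim: i => [|i IH]; first by case: (pwS j).
  have [y y_ yj] := pmul_assocr mA IH (pwS (i + j).+1).1.
  by move: y_; rewrite (pwS i).1 => -[yE]; rewrite [pw i.+1]yE yj addSn.
have pw_stab n : m (pw n) a = Some a by case: (pwS n).
have [i [j [ij pwij]]] : exists i j, (i < j)%N /\ pw i = pw j.
  apply: contrapT => /forallNP h; have inj : injective pw.
    move=> i j e; apply/eqP; case: (ltngtP i j) => // lt.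
      by exfalso; apply: (h i); exists j.
    by exfalso; apply: (h j); exists i.
  have /eq_finite_set e := @inj_card_eq _ _ [set: nat] pw (in2W inj).
  apply: infinite_nat; rewrite -e; apply: sub_finite_set (finite_left_stab a).
  by move=> _ [n _ <-]; exact: pw_stab.
pose d := (j - i)%N.
have per n : (i <= n)%N -> pw n = pw (n + d)%N.
  move=> /subnKC <-; elim: (n - i)%N => [|k IH].
    by rewrite addn0 /d subnKC // ltnW.
  have := congr1 (m p) IH; rewrite (pwS _).1 (pwS (i + k + d)%N).1 => -[e].
  by rewrite addnS addSn.
have perk k n : (i <= n)%N -> pw n = pw (n + k * d)%N.
  move=> lin; elim: k => [|k IH]; first by rewrite mul0n addn0.
  by rewrite IH per ?(leq_trans lin) ?leq_addr // mulSn addnCA addnC.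
have d0 : (0 < d)%N by rewrite subn_gt0.
(* The exponent n + 1 is a multiple of the period d with n >= i, so squaring p^(n+1) shifts the
   exponent by whole periods. *)
pose n := (i.+1 * d).-1.
have nE : n.+1 = (i.+1 * d)%N by rewrite prednK // muln_gt0.
have lin : (i <= n)%N by rewrite -ltnS nE leq_pmulr.
have nid : idem m (pw n).
  by apply: (sg_idem Gsg); rewrite pwD (perk i.+1 n lin) -nE addnS.
case: {+}n nid => [//|k] kid.
by case: (idem_factors kid (pwS k).1) => ->.
Qed.

Lemma left_unit_ex a : exists e, m e a = Some a.
Proof. by have [e [f [_ _ ea _]]] := sg_unit Gsg a; exists e. Qed.

Definition lunit a : G := projT1 (cid (left_unit_ex a)).

Lemma lunitP a : m (lunit a) a = Some a.
Proof. exact: projT2 (cid (left_unit_ex a)). Qed.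

Lemma lunit_idem a : idem m (lunit a).
Proof. exact: left_stab_idem (lunitP a). Qed.

(** The product of two left units of a is defined and, both being idempotent, equals each of
    them. *)
Lemma lunit_uniq a p : m p a = Some a -> p = lunit a.
Proof.
move=> pa; have pid := left_stab_idem pa.
have [x x_ _] := pmul_assocr mA (lunitP a) pa.
by rewrite -(pid.1 _ _ x_) ((lunit_idem a).2 _ _ x_).
Qed.

Lemma sg_le_factorl p q a : m p q = Some a -> sg_le m p a.
Proof.
move=> pq; exists (lunit a), q.
by rewrite (sg_assoc Gsg) /mul3r pq /= lunitP.
Qed.

Lemma sg_le_factorr p q a : m p q = Some a -> sg_le m q a.
Proof.
move=> pq; have [e [f [_ _ _ af]]] := sg_unit Gsg a.
by exists p, f; rewrite /mul3l pq.
Qed.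

Lemma sg_le_refl a : sg_le m a a.
Proof. exact: sg_le_factorr (lunitP a). Qed.

Lemma sg_le_trans b a c : sg_le m b a -> sg_le m c b -> sg_le m c a.
Proof.
move=> [z [w]]; rewrite /mul3l; case zb: (m z b) => [u|//] /= uw.
move=> [z' [w']]; rewrite /mul3l; case zc: (m z' c) => [t|//] /= tw.
have [s zt sw'] := pmul_assocr mA tw zb.
have [zz _ zzc] := pmul_assocr mA zc zt.
have [ww _ sww] := pmul_assocl mA sw' uw.
by exists zz, ww; rewrite /mul3l zzc.
Qed.

Lemma finite_sg_le a : finite_set [set b | sg_le m b a].
Proof.
apply: (@sub_finite_set _ _ ((fun t : G * G * G => t.1.2) @`
  [set t : G * G * G | mul3l m t.1.1 t.1.2 t.2 = Some a])); last first.
  exact/finite_image/(sg_finite Gsg).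
by move=> b [z [w zbw]]; exists (z, b, w).
Qed.

(** Each element has finitely many divisors, so positivity on [G] need only be tested on finite
    lower sets. *)
Lemma lower_hull (A : {fset G}) :
  exists2 F : {fset G}, lower m [set` F] & {subset A <= F}.
Proof.
pose H := [set b | exists2 a, a \in A & sg_le m b a].
have fH : finite_set H.
  apply: (@sub_finite_set _ _ (\bigcup_(a in [set` A]) [set b | sg_le m b a])).
    by move=> b [a aA ba]; exists a.
  apply: bigcup_finite; first exact: finite_fset.
  by move=> a _; exact: finite_sg_le.
exists (fset_set H); last first.
  move=> a aA; rewrite in_fset_set // inE; exists a => //; exact: sg_le_refl.
move=> a b /=; rewrite !in_fset_set // !inE => -[c cA ac] ba.
by exists c => //; exact: sg_le_trans ac ba.
Qed.

Definition ldiv a : set G := [set q | exists p, m p q = Some a].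

Lemma finite_ldiv a : finite_set (ldiv a).
Proof.
apply: sub_finite_set (finite_sg_le a) => q [p pq].
exact: sg_le_factorr pq.
Qed.

Definition rank a : nat := #|` fset_set (ldiv a)|.

(** If a were a right factor of q, say q = p' a, then p p' would fix a and so be idempotent; its
    factor p' would be idempotent too, forcing q = a. *)
Lemma rank_lt p q a : m p q = Some a -> q != a -> (rank q < rank a)%N.
Proof.
move=> pq qa; apply: fproper_ltn_card; rewrite fproperEneq andbC.
apply/andP; split.
  apply/fsubsetP => x; rewrite !in_fset_set; try exact: finite_ldiv.
  rewrite !inE => -[p' p'x].
  by have [pp _] := pmul_assocr mA p'x pq; exists pp.
apply/eqP => /fsetP/(_ a); rewrite !in_fset_set; try exact: finite_ldiv.
have -> : a \in ldiv a by rewrite inE; exists (lunit a); exact: lunitP.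
move=> /set_mem[p' p'a].
have [pp pp_ ppa] := pmul_assocr mA p'a pq.
have ppid := left_stab_idem ppa.
have [_ p'E] := idem_factors ppid pp_.
by move: p'a qa; rewrite p'E => /ppid.1 ->; rewrite eqxx.
Qed.

Lemma lower_factors (F : {fset G}) : lower m [set` F] ->
  forall p q a, m p q = Some a -> a \in F -> p \in F /\ q \in F.
Proof.
move=> lF p q a pq aF; split.
  exact: lF aF (sg_le_factorl pq).
exact: lF aF (sg_le_factorr pq).
Qed.

(** An intermediate product divides the final one, so it cannot leave the lower set [F]. *)
Lemma resm_assoc (F : {fset G}) (lF : lower m [set` F]) (a b c : F) :
  mul3l (resm m F) a b c = mul3r (resm m F) a b c.
Proof.
have hl x : mul3l (resm m F) a b c = Some x -> mul3r (resm m F) a b c = Some x.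
  rewrite /mul3l; case ab_: (resm m F a b) => [ab|//] /= /resmP abc.
  move/resmP: ab_ => ab_; have [bc bc_ x_] := pmul_assocl mA ab_ abc.
  have [_ bcF] := lower_factors lF x_ (valP x).
  rewrite /mul3r (_ : resm m F b c = Some [` bcF]%fset) /=; exact/resmP.
have hr x : mul3r (resm m F) a b c = Some x -> mul3l (resm m F) a b c = Some x.
  rewrite /mul3r; case bc_: (resm m F b c) => [bc|//] /= /resmP abc.
  move/resmP: bc_ => bc_; have [ab ab_ x_] := pmul_assocr mA bc_ abc.
  have [abF _] := lower_factors lF x_ (valP x).
  rewrite /mul3l (_ : resm m F a b = Some [` abF]%fset) /=; exact/resmP.
case e: (mul3l _ _ _ _) => [x|]; first by rewrite (hl _ e).
by case e': (mul3r _ _ _ _) => [x|//]; rewrite (hr _ e') in e.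
Qed.

End SemigroupoidTheory.

(** * Positive forms and unitary matrices *)

Section Forms.
Variable C : numClosedFieldType.
Implicit Types I J L : finType.

Definition ip I (u v : I -> C) : C := \sum_i (u i)^* * v i.
Definition mv I J (M : I -> J -> C) (v : J -> C) : I -> C :=
  fun i => \sum_j M i j * v j.
Definition adj I J (M : I -> J -> C) : J -> I -> C := fun j i => (M i j)^*.
Definition mm I J L (M : I -> J -> C) (N : J -> L -> C) : I -> L -> C :=
  fun i l => \sum_j M i j * N j l.

Lemma ipDl I (u v w : I -> C) : ip (u + v) w = ip u w + ip v w.
Proof. by rewrite -big_split; apply: eq_bigr => i _; rewrite rmorphD mulrDl. Qed.

Lemma ipDr I (u v w : I -> C) : ip w (u + v) = ip w u + ip w v.
Proof. by rewrite -big_split; apply: eq_bigr => i _; rewrite mulrDr. Qed.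

Lemma ipZl I c (u v : I -> C) : ip (fun i => c * u i) v = c^* * ip u v.
Proof. by rewrite mulr_sumr; apply: eq_bigr => i _; rewrite rmorphM mulrA. Qed.

Lemma ipZr I c (u v : I -> C) : ip u (fun i => c * v i) = c * ip u v.
Proof. by rewrite mulr_sumr; apply: eq_bigr => i _; rewrite mulrCA. Qed.

Lemma ipNl I (u v : I -> C) : ip (- u) v = - ip u v.
Proof. by rewrite -sumrN; apply: eq_bigr => i _; rewrite rmorphN mulNr. Qed.

Lemma ipNr I (u v : I -> C) : ip u (- v) = - ip u v.
Proof. by rewrite -sumrN; apply: eq_bigr => i _; rewrite mulrN. Qed.

Lemma ipC I (u v : I -> C) : (ip u v)^* = ip v u.
Proof.
by rewrite rmorph_sum; apply: eq_bigr => i _; rewrite rmorphM /= conjCK mulrC.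
Qed.

Lemma ip_ge0 I (u : I -> C) : 0 <= ip u u.
Proof. by apply: sumr_ge0 => i _; rewrite mulrC mul_conjC_ge0. Qed.

Lemma ip_eq0 I (u : I -> C) : ip u u = 0 -> u = 0.
Proof.
move=> u0; apply/funext => i; apply/eqP; rewrite -mul_conjC_eq0 mulrC.
move/eqP: u0; rewrite psumr_eq0 => [|j _]; last by rewrite mulrC mul_conjC_ge0.
by move/allP/(_ i (mem_index_enum i)).
Qed.

Lemma mvD I J (M : I -> J -> C) u v : mv M (u + v) = mv M u + mv M v.
Proof.
apply/funext => i; rewrite -[RHS]/(mv M u i + mv M v i) /mv -big_split.
by apply: eq_bigr => j _; rewrite mulrDr.
Qed.

Lemma mvN I J (M : I -> J -> C) u : mv M (- u) = - mv M u.
Proof.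
apply/funext => i; rewrite -[RHS]/(- mv M u i) /mv -sumrN.
by apply: eq_bigr => j _; rewrite mulrN.
Qed.

Lemma mvZ I J (M : I -> J -> C) c u :
  mv M (fun j => c * u j) = fun i => c * mv M u i.
Proof.
apply/funext => i; rewrite /mv mulr_sumr; apply: eq_bigr => j _.
by rewrite mulrCA.
Qed.

Lemma mv_mm I J L (M : I -> J -> C) (N : J -> L -> C) u :
  mv (mm M N) u = mv M (mv N u).
Proof.
apply/funext => i; rewrite /mv /mm; under eq_bigr do rewrite mulr_suml.
rewrite exchange_big; apply: eq_bigr => j _.
by rewrite mulr_sumr; apply: eq_bigr => l _; rewrite mulrA.
Qed.

Lemma ip_adj I J (M : I -> J -> C) u v : ip u (mv M v) = ip (mv (adj M) u) v.
Proof.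
rewrite /ip /mv /adj; under eq_bigr do rewrite mulr_sumr.
rewrite exchange_big; apply: eq_bigr => j _.
rewrite rmorph_sum mulr_suml; apply: eq_bigr => i _.
by rewrite rmorphM /= conjCK; ring.
Qed.

Lemma adjK I J (M : I -> J -> C) : adj (adj M) = M.
Proof. by apply/funext => i; apply/funext => j; rewrite /adj conjCK. Qed.

Definition posm I (M : I -> I -> C) := forall u : I -> C, 0 <= ip u (mv M u).

Definition herm I (M : I -> I -> C) := forall i j, M i j = (M j i)^*.

Lemma ip_herm I (M : I -> I -> C) u v :
  herm M -> ip u (mv M v) = ip (mv M u) v.
Proof.
move=> h; rewrite ip_adj; congr (ip (mv _ _) _).
by apply/funext => i; apply/funext => j; rewrite /adj -h.
Qed.

Lemma ip_delta I (i : I) (v : I -> C) : ip (fun j => (j == i)%:R) v = v i.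
Proof.
rewrite /ip (bigD1 i) //= big1 ?addr0; last first.
  by move=> j /negbTE ->; rewrite conjC0 mul0r.
by rewrite eqxx conjC1 mul1r.
Qed.

Lemma mv_delta I J (M : I -> J -> C) (j : J) :
  mv M (fun k => (k == j)%:R) = M^~ j.
Proof.
apply/funext => i; rewrite /mv (bigD1 j) //= big1 ?addr0; last first.
  by move=> k /negbTE ->; rewrite mulr0.
by rewrite eqxx mulr1.
Qed.

(** Polarisation: the form is real at e_i + e_j and at e_i + 'i e_j. *)
Lemma posm_herm I (M : I -> I -> C) : posm M -> herm M.
Proof.
move=> pM i j.
pose u : I -> C := fun k => (k == i)%:R; pose v : I -> C := fun k => (k == j)%:R.
have entry : ip u (mv M v) = M i j by rewrite ip_delta mv_delta.
have entry' : ip v (mv M u) = M j i by rewrite ip_delta mv_delta.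
have real x : ip x (mv M x) \is Num.real by exact: ger0_real.
have := real (u + v); rewrite mvD ipDl !ipDr entry entry'.
have := real (u + (fun k => 'i * v k)).
rewrite mvD mvZ ipDl !ipDr ipZr !ipZl ipZr entry entry' conjCi mulrA.
have -> : - 'i * 'i = 1 :> C by rewrite mulNr -expr2 sqrCi opprK.
rewrite mul1r => r2 r1.
have {r1} : M i j + M j i \is Num.real.
  rewrite (_ : _ + _ = ip u (mv M u) + M i j + (M j i + ip v (mv M v))
    - ip u (mv M u) - ip v (mv M v)); last by ring.
  by rewrite rpredB // rpredB.
have {r2} : 'i * M i j - 'i * M j i \is Num.real.
  rewrite (_ : _ - _ = ip u (mv M u) + 'i * M i j + (- 'i * M j i + ip v (mv M v))
    - ip u (mv M u) - ip v (mv M v)); last by ring.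
  by rewrite rpredB // rpredB.
move=> /CrealP; rewrite rmorphB !rmorphM /= conjCi => e1 /CrealP.
rewrite rmorphD /= => e2.
have i0 : 'i != 0 :> C := neq0Ci C.
have e1' : (M j i)^* - (M i j)^* = M i j - M j i.
  by apply: (mulfI i0); rewrite mulrBr [RHS]mulrBr -e1; ring.
have : 2%:R * M i j = 2%:R * (M j i)^*.
  transitivity ((M i j - M j i) + (M i j + M j i)); first by ring.
  by rewrite -e1' -e2; ring.
by apply: mulfI; rewrite pnatr_eq0.
Qed.

Lemma posm_congr I J (M : I -> I -> C) (T : I -> J -> C) :
  posm M -> posm (mm (adj T) (mm M T)).
Proof. by move=> pM u; rewrite !mv_mm ip_adj adjK; exact: pM. Qed.

(* Expanding the nonnegative number <w, K w> for w = T^* K' T x - K' x. *)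
Lemma contractive_inv I (K K' T : I -> I -> C) :
  posm K -> (forall v, mv K (mv K' v) = v) ->
  (forall u, ip (mv (adj T) u) (mv K (mv (adj T) u)) <= ip u (mv K u)) ->
  forall x, ip (mv T x) (mv K' (mv T x)) <= ip x (mv K' x).
Proof.
move=> pK KK' KT x; have hK := posm_herm pK.
set z := mv K' (mv T x); set w := mv K' x.
have Kz : mv K z = mv T x by rewrite /z KK'.
have Kw : mv K w = x by rewrite /w KK'.
set t := mv (adj T) z.
have tx : ip t x = ip z (mv K z) by rewrite /t -ip_adj Kz.
have xt : ip x t = ip z (mv K z).
  by rewrite -ipC tx (CrealP _) // ger0_real.
have ww : ip w x = ip x w by rewrite -{1}Kw (ip_herm _ _ hK) Kw.
have zz : ip (mv T x) z = ip z (mv K z) by rewrite -Kz (ip_herm _ _ hK).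
rewrite zz -subr_ge0.
have := addr_ge0 (pK (t - w)) (etrans (subr_ge0 _ _) (KT z)).
rewrite mvD mvN ipDl !ipDr !ipNl !ipNr (ip_herm w t hK) Kw tx xt ww -/t.
by congr (0 <= _); ring.
Qed.

(** A null vector u of M + e would satisfy <u, M u> + e <u, u> = 0, a sum of nonnegative terms. *)
Lemma regularized_inv I (M : I -> I -> C) (e : C) : posm M -> 0 < e ->
  exists K' : I -> I -> C,
    (forall i l, \sum_j (M i j + e * (i == j)%:R) * K' j l = (i == l)%:R) /\
    (forall i l, \sum_j K' i j * (M j l + e * (j == l)%:R) = (i == l)%:R).
Proof.
move=> pM e0; pose n := #|I|.
pose A : 'M[C]_n := \matrix_(i, j)
  (M (enum_val i) (enum_val j) + e * (enum_val i == enum_val j)%:R).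
have sumE (F : I -> C) : \sum_j F j = \sum_(k : 'I_n) F (enum_val k).
  by rewrite (reindex (@enum_val I I)) //; exact/onW_bij/enum_val_bij.
have uA : A \in unitmx.
  rewrite unitmxE unitfE; apply/negP => /det0P[v v0 vA].
  pose u i := (v 0 (enum_rank i))^*.
  have : ip u (mv (fun i j => M i j + e * (i == j)%:R) u) = 0.
    rewrite ip_adj /ip big1 // => j _; rewrite [X in X^*](_ : _ = 0) ?conjC0 ?mul0r //.
    rewrite /mv /adj sumE.
    have := congr1 (fun B : 'rV_n => (B 0 (enum_rank j))^*) vA.
    rewrite !mxE rmorph_sum /= conjC0; apply: etrans; apply: eq_bigr => k _.
    by rewrite /u enum_valK !mxE enum_rankK rmorphM mulrC.
  have -> : mv (fun i j => M i j + e * (i == j)%:R) u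
            = mv M u + (fun i => e * u i).
    apply/funext => i; rewrite [RHS]/(mv M u i + e * u i) /mv.
    under eq_bigr do rewrite mulrDl; rewrite big_split /=; congr (_ + _).
    rewrite (bigD1 i) //= eqxx mulr1 big1 ?addr0 // => j.
    by rewrite eq_sym => /negbTE ->; rewrite mulr0 mul0r.
  rewrite ipDr ipZr => /eqP.
  rewrite (paddr_eq0 (pM u) (mulr_ge0 (ltW e0) (ip_ge0 u))).
  move=> /andP[_]; rewrite mulf_eq0 (gt_eqF e0) /= => /eqP/ip_eq0 u0.
  case/negP: v0; apply/eqP/rowP => k; rewrite mxE.
  have := congr1 (fun f => (f (enum_val k))^*) u0.
  by rewrite /u enum_valK conjCK conjC0.
exists (fun i j => invmx A (enum_rank i) (enum_rank j)); split=> i l.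
  have := congr1 (fun B : 'M[C]_n => B (enum_rank i) (enum_rank l)) (mulmxV uA).
  rewrite !mxE (inj_eq enum_rank_inj) => <-; rewrite sumE.
  by apply: eq_bigr => k _; rewrite !mxE enum_valK enum_rankK.
have := congr1 (fun B : 'M[C]_n => B (enum_rank i) (enum_rank l)) (mulVmx uA).
rewrite !mxE (inj_eq enum_rank_inj) => <-; rewrite sumE.
by apply: eq_bigr => k _; rewrite !mxE enum_valK enum_rankK.
Qed.

End Forms.

(** * Unitary matrices with prescribed values on finitely many vectors *)

Section Unitary.
Variable C : numClosedFieldType.

Definition adjmx m n (A : 'M[C]_(m, n)) : 'M[C]_(n, m) := map_mx Num.conj A^T.

Lemma adjmxM m n p (A : 'M[C]_(m, n)) (B : 'M[C]_(n, p)) :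
  adjmx (A *m B) = adjmx B *m adjmx A.
Proof. by rewrite /adjmx trmx_mul map_mxM. Qed.

Lemma adjmxK m n (A : 'M[C]_(m, n)) : adjmx (adjmx A) = A.
Proof. by apply/matrixP => i j; rewrite !mxE conjCK. Qed.

(* The complex Householder reflection x |-> x - (<x, w> / <u, w>) w, with
   w = u - v, which is unitary because 2 Re <u, w> = <w, w>. *)
Lemma householder d (u v : 'rV[C]_d) : u *m adjmx u = v *m adjmx v ->
  exists U : 'M[C]_d, [/\ U *m adjmx U = 1%:M, u *m U = v &
    forall x : 'rV[C]_d, x *m adjmx u = x *m adjmx v -> x *m U = x].
Proof.
move=> uv; have [->|nuv] := eqVneq u v.
  exists 1%:M; split=> [||x _]; rewrite ?mulmx1 //.
  by rewrite mul1mx; apply/matrixP => i j; rewrite !mxE eq_sym conjC_nat.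
set w := u - v; pose om := (w *m adjmx w) 0 0; pose tau := (u *m adjmx w) 0 0.
have omE : w *m adjmx w = om%:M by rewrite [LHS]mx11_scalar.
have tauE : u *m adjmx w = tau%:M by rewrite [LHS]mx11_scalar.
have adjB (x y : 'rV[C]_d) : adjmx (x - y) = adjmx x - adjmx y.
  by rewrite /adjmx linearB map_mxB.
have om_tau : om = tau + tau^*.
  have -> : tau^* = (w *m adjmx u) 0 0.
    have := congr1 (fun A => adjmx A 0 0) tauE.
    by rewrite adjmxM adjmxK !mxE eqxx mulr1n => ->.
  rewrite /om /tau /w !adjB !mulmxBl !mulmxBr uv !mxE; ring.
have om0 : om != 0.
  rewrite /om mxE; under eq_bigr do rewrite !mxE.
  rewrite psumr_eq0 => [|j _]; last exact: mul_conjC_ge0.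
  apply/negP => /allP h; case/negP: nuv; apply/eqP/rowP => j.
  have := h j (mem_index_enum j); rewrite /= mul_conjC_eq0 subr_eq0.
  by move/eqP.
have tau0 : tau != 0.
  by apply/negP => /eqP t0; case/negP: om0; rewrite om_tau t0 conjC0 addr0.
exists (1%:M - tau^-1 *: (adjmx w *m w)).
have xU (x : 'rV[C]_d) : x *m (1%:M - tau^-1 *: (adjmx w *m w))
    = x - (tau^-1 * (x *m adjmx w) 0 0) *: w.
  rewrite mulmxBr mulmx1 -scalemxAr mulmxA [x *m adjmx w]mx11_scalar.
  by rewrite mul_scalar_mx scalerA !mxE eqxx mulr1n.
split; last first.
- move=> x xuv; rewrite xU /w adjB mulmxBr xuv subrr mxE mulr0 scale0r.
  by rewrite subr0.
- by rewrite xU -/tau mulVf // scale1r /w opprB addrC subrK.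
have -> : adjmx (1%:M - tau^-1 *: (adjmx w *m w))
          = 1%:M - (tau^*)^-1 *: (adjmx w *m w) :> 'M[C]_d.
  rewrite -fmorphV -{2}(adjmxK w) -adjmxM /adjmx.
  apply/matrixP => i j; rewrite !mxE rmorphB rmorphM /= conjC_nat eq_sym.
  congr (_ - _ * _); rewrite !rmorph_sum; apply: eq_bigr => k _.
  by rewrite !mxE !rmorphM /= !conjCK.
have WW : (adjmx w *m w) *m (adjmx w *m w) = om *: (adjmx w *m w).
  by rewrite mulmxA -[_ *m w *m _]mulmxA omE mul_mx_scalar -scalemxAl.
move: (adjmx w *m w) WW => W WW.
(* With W W = om W, unitarity of 1 - W / tau reduces to this scalar identity. *)
have e : tau^-1 + (tau^*)^-1 - tau^-1 * (tau^*)^-1 * om = 0.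
  by rewrite om_tau; field; rewrite tau0 andbT; rewrite conjC_eq0.
rewrite mulmxBl !mulmxBr !mul1mx mulmx1 -scalemxAl -scalemxAr WW !scalerA.
apply/matrixP => i j; rewrite !mxE; apply/eqP; rewrite -subr_eq0; apply/eqP.
by rewrite -[RHS](mul0r (- W i j)) -e; ring.
Qed.

(** Given U correct on the earlier vectors, a reflection takes a_n U to b_n. Equality of the Gram
    matrices gives the earlier b_i the same inner product with both, so the reflection fixes
    them. *)
Lemma unitary_extension d n (a b : nat -> 'rV[C]_d) :
  (forall i j, (i < n)%N -> (j < n)%N ->
    a i *m adjmx (a j) = b i *m adjmx (b j)) ->
  exists2 U : 'M[C]_d, U *m adjmx U = 1%:M &
    forall i, (i < n)%N -> a i *m U = b i.
Proof.
elim: n => [_|n IH gram].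
  exists 1%:M => //; rewrite mul1mx; apply/matrixP => i j.
  by rewrite !mxE eq_sym conjC_nat.
have [|U UU aU] := IH.
  by move=> i j ilt jlt; apply: gram; exact: ltnW.
have UV (x y : 'rV[C]_d) : x *m U *m adjmx (y *m U) = x *m adjmx y.
  by rewrite adjmxM mulmxA -[x *m U *m _]mulmxA UU mulmx1.
have [|V [VV uV Vfix]] := @householder d (a n *m U) (b n).
  by rewrite UV gram.
exists (U *m V).
  by rewrite adjmxM mulmxA -[U *m V *m _]mulmxA VV mulmx1.
move=> i; rewrite ltnS leq_eqVlt mulmxA => /orP[/eqP -> //|ilt].
by rewrite aU // Vfix // -{1}aU // UV gram // ltnW.
Qed.

End Unitary.

(** * Kernels on finite lower sets *)

Section Positivity.
Variable R : realType.
Local Notation C := R[i].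

Lemma psdE (I : finType) (M : I -> I -> C) : psd M <-> posm M.
Proof.
suff e u : \sum_i \sum_j (u i)^* * M i j * u j = ip u (mv M u).
  by split=> h u; have := h u; rewrite e.
apply: eq_bigr => i _; rewrite mulr_sumr; apply: eq_bigr => j _.
by rewrite mulrA.
Qed.

(** The pulled-back form at u is the form of M at the fibre sums of u; h need not be injective,
    which covers restriction and reindexing alike. *)
Lemma posm_comp (I J : finType) (h : J -> I) (M : I -> I -> C) :
  posm M -> posm (fun j k => M (h j) (h k)).
Proof.
move=> pM u; pose u' i := \sum_(j | h j == i) u j.
have pushE (g : I -> C) : \sum_i g i * u' i = \sum_j g (h j) * u j.
  rewrite [RHS](partition_big h xpredT) //=; apply: eq_bigr => i _.
  by rewrite mulr_sumr; apply: eq_bigr => j /eqP ->.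
have := pM u'; rewrite /ip.
have -> : \sum_i (u' i)^* * mv M u' i = (\sum_i (mv M u' i)^* * u' i)^*.
  by rewrite rmorph_sum; apply: eq_bigr => i _; rewrite rmorphM /= conjCK mulrC.
rewrite pushE rmorph_sum; congr (0 <= _); apply: eq_bigr => j _.
by rewrite rmorphM /= conjCK mulrC; congr (_ * _); exact: pushE.
Qed.

Lemma pos_kernel_fin (T : choiceType) (F : {fset T}) (k : F -> F -> C) :
  pos_kernel k <-> posm k.
Proof.
split=> [pk|pk A]; last by apply/psdE; exact: posm_comp.
have /psdE p := pk (fset_set [set: F]).
have inT (x : F) : x \in fset_set [set: F].
  by rewrite in_fset_set ?in_setT //; exact: finite_finset.
exact: (posm_comp (fun x => [` inT x]%fset)) p.
Qed.

Lemma pos_kernel_kres (T : choiceType) (F : {fset T}) (k : T -> T -> C) :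
  pos_kernel k -> posm (kres k : F -> F -> C).
Proof. by move=> /(_ F)/psdE. Qed.

Lemma pos_kernel_sub (T : choiceType) (F : {fset T}) (A : {fset T})
    (k : T -> T -> C) : {subset A <= F} ->
  posm (kres k : F -> F -> C) -> psd (fun a b : A => k (val a) (val b)).
Proof.
move=> AF pk; apply/psdE.
exact: (posm_comp (fun x : A => [` AF _ (valP x)]%fset)) pk.
Qed.

End Positivity.

Section FiniteKernels.
Variables (R : realType) (G : choiceType) (m : pmul G) (Gsg : semigroupoid m).
Variables (F : {fset G}) (lF : lower m [set` F]).
Local Notation C := R[i].
Local Notation mF := (resm m F).

(** The unit of the convolution algebra along [g]: with [id] it lives on [G], with [val] on a finite
    lower set. *)
Definition idf (T : Type) (g : T -> G) (x : T) : C := `[< idem m (g x) >]%:R.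

Lemma koneE (x y : G) : kone R m x y = idf id x * (idf id y)^*.
Proof.
rewrite /kone /idf; case: (asboolP (idem m x)) => ix.
  rewrite mul1r; case: (asboolP (idem m y)) => iy.
    by rewrite asboolT // conjC1.
  by rewrite asboolF ?conjC0 // => -[].
by rewrite mul0r asboolF // => -[].
Qed.

Definition tz (f : F -> C) : F -> F -> C := toeplitz mF f.

Lemma fsum_fin (I : finType) (P : set I) (Q : pred I) (H : I -> C) :
  (forall i, P i <-> Q i) -> \sum_(i \in P) H i = \sum_(i | Q i) H i.
Proof.
move=> PQ; have -> : P = [set` Q] by apply/seteqP; split=> i /= /PQ.
apply/esym/bigfs; first exact: index_enum_uniq.
by move=> i _; rewrite mem_index_enum.
Qed.

Lemma sum_factor (H : F * F -> C) a :
  \sum_(p \in Defs.factor mF a) H p = \sum_q \sum_(c | mF c q == Some a) H (c, q).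
Proof.
rewrite (fsum_fin (Q := fun p : F * F => mF p.1 p.2 == Some a)); last first.
  by move=> p; split=> /eqP.
rewrite pair_big_dep /= (reindex (fun p : F * F => (p.2, p.1))) /=.
  by apply: eq_bigl => -[].
by exists (fun p : F * F => (p.2, p.1)) => -[].
Qed.

Lemma kstarB (A B K : F -> F -> C) a b :
  kstar mF (fun x y => A x y - B x y) K a b = kstar mF A K a b - kstar mF B K a b.
Proof.
rewrite /kstar !sum_factor -sumrB; apply: eq_bigr => q _.
rewrite -sumrB; apply: eq_bigr => c _; rewrite !sum_factor -sumrB.
apply: eq_bigr => s _; rewrite -sumrB; apply: eq_bigr => d _ /=.
by rewrite mulrBl.
Qed.

Lemma kstarZ (z : C) (A K : F -> F -> C) a b :
  kstar mF (fun x y => z * A x y) K a b = z * kstar mF A K a b.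
Proof.
rewrite /kstar !sum_factor mulr_sumr; apply: eq_bigr => q _.
rewrite mulr_sumr; apply: eq_bigr => c _; rewrite !sum_factor mulr_sumr.
apply: eq_bigr => s _; rewrite mulr_sumr; apply: eq_bigr => d _ /=.
by rewrite mulrA.
Qed.

Lemma kstar_outer (f : F -> C) (K : F -> F -> C) a b :
  kstar mF (outer f) K a b = mm (tz f) (mm K (adj (tz f))) a b.
Proof.
rewrite /kstar sum_factor; apply: eq_bigr => q _.
rewrite /tz /toeplitz mulr_suml; apply: eq_bigr => c _; rewrite sum_factor /=.
rewrite mulr_sumr; apply: eq_bigr => s _; rewrite /adj rmorph_sum !mulr_sumr.
by apply: eq_bigr => d _; rewrite /outer /=; ring.
Qed.

(** An idempotent c with c b = a forces a = b, and left units are unique, so each diagonal entry has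
    exactly one nonzero term. *)
Lemma tz_delta a b : tz (idf val) a b = (a == b)%:R.
Proof.
rewrite /tz /toeplitz; have [<-|ab] := eqVneq a b.
  have uP := lunitP Gsg (val a).
  have uF : lunit Gsg (val a) \in F by case: (lower_factors Gsg lF uP (valP a)).
  rewrite (big_pred1 [` uF]%fset) /=.
    by rewrite /idf asboolT //; exact: lunit_idem.
  move=> c /=; apply/eqP/eqP => [/resmP ca|->]; last exact/resmP.
  by apply: val_inj; exact: lunit_uniq ca.
rewrite big1 // => c /eqP/resmP cb; rewrite /idf; case: asboolP => // ic.
by case/negP: ab; apply/eqP/val_inj; exact: ic.1 cb.
Qed.

Lemma mm_delta (I : finType) (K : I -> F -> C) : mm K (adj (tz (idf val))) = K.
Proof.
apply/funext => a; apply/funext => b; rewrite /mm /adj (bigD1 b) //= big1 => [|c].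
  by rewrite tz_delta eqxx conjC1 mulr1 addr0.
by rewrite tz_delta eq_sym => /negbTE ->; rewrite conjC0 mulr0.
Qed.

Lemma delta_mm (J : finType) (K : F -> J -> C) : mm (tz (idf val)) K = K.
Proof.
apply/funext => a; apply/funext => b; rewrite /mm (bigD1 a) //= big1 => [|c].
  by rewrite tz_delta eqxx mul1r addr0.
by rewrite tz_delta eq_sym => /negbTE ->; rewrite mul0r.
Qed.

Lemma kstar_defect (z : C) (f : F -> C) (K : F -> F -> C) a b :
  kstar mF (fun x y => z * kone R m (val x) (val y) - outer f x y) K a b =
  z * K a b - mm (tz f) (mm K (adj (tz f))) a b.
Proof.
rewrite kstarB kstarZ kstar_outer; congr (_ * _ - _).
rewrite (_ : (fun _ _ => _) = outer (idf val)); last first.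
  by apply/funext => x; apply/funext => y; rewrite koneE.
by rewrite kstar_outer mm_delta delta_mm.
Qed.

Lemma defect_form (z : C) (T K : F -> F -> C) u :
  ip u (mv (fun a b => z * K a b - mm T (mm K (adj T)) a b) u) =
  z * ip u (mv K u) - ip (mv (adj T) u) (mv K (mv (adj T) u)).
Proof.
rewrite -ipZr -[X in _ = _ - X](_ : ip u (mv (mm T (mm K (adj T))) u) = _).
  rewrite -ipNr -ipDr; congr ip; apply/funext => a.
  rewrite -[RHS]/(z * mv K u a - mv (mm T (mm K (adj T))) u a) /mv mulr_sumr.
  by rewrite -sumrB; apply: eq_bigr => b _; ring.
by rewrite !mv_mm ip_adj.
Qed.

Lemma factor_bij (z : F) : set_bij (Defs.factor mF z) (Defs.factor m (val z))
  (fun p : F * F => (val p.1, val p.2)).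
Proof.
split.
- by move=> p /resmP.
- by move=> [p1 p2] [q1 q2] _ _ [/val_inj -> /val_inj ->].
- move=> [p q] /= pq; have [pF qF] := lower_factors Gsg lF pq (valP z).
  by exists ([` pF], [` qF])%fset => //; exact/resmP.
Qed.

Lemma kstar_res (A B : G -> G -> C) (x y : F) :
  kstar m A B (val x) (val y) = kstar mF (kres A) (kres B) x y.
Proof.
rewrite /kstar (reindex_fsbig _ _ _ _ (factor_bij x)).
by apply: eq_fsbigr => p _; rewrite (reindex_fsbig _ _ _ _ (factor_bij y)).
Qed.

Lemma mv_tz (f v : F -> C) a :
  mv (tz f) v a = \sum_q \sum_(c | mF c q == Some a) f c * v q.
Proof. by apply: eq_bigr => q _; rewrite mulr_suml. Qed.

Lemma fres_star (phi v : G -> C) :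
  mv (tz (fres phi)) (fres v) = fres (F := F) (star m phi v).
Proof.
apply/funext => x.
rewrite -[RHS]/(star m phi v (val x)) /star.
by rewrite (reindex_fsbig _ _ _ _ (factor_bij x)) sum_factor mv_tz.
Qed.

End FiniteKernels.

(** * Toeplitz contractions and tests on finite lower sets *)

Section TestFunctionKernels.
Variables (R : realType) (G : choiceType) (m : pmul G) (Gsg : semigroupoid m).
Local Notation C := R[i].
Variables (Psi : set {ptws G -> C}) (PsiT : test_functions m Psi).

Lemma l2normE (I : finType) (v : I -> C) : (l2norm v ^+ 2)%:C%C = ip v v.
Proof.
rewrite /l2norm sqr_sqrtr; last by apply: sumr_ge0 => i _; exact: sqr_ge0.
rewrite rmorph_sum; apply: eq_bigr => i _.
by rewrite rmorphXn /= ReK_norm normCK mulrC.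
Qed.

Lemma l2norm_le1 (I : finType) (v : I -> C) : (l2norm v <= 1) = (ip v v <= 1).
Proof.
by rewrite -l2normE -[1 in RHS]/(1%:C)%C lecR expr_le1 // sqrtr_ge0.
Qed.

(** The supremum dominates its set only once that set is known to be bounded, hence the explicit
    bound; homogeneity then leads from the unit ball to all vectors. *)
Lemma contractive_of_opnorm (I : finType) (M : I -> I -> C) :
  opnorm M <= 1 -> forall v, ip (mv M v) (mv M v) <= ip v v.
Proof.
move=> M1.
have bnd : has_ubound [set l2norm (mxapply M v) | v in [set v | l2norm v <= 1]].
  exists (Num.sqrt (\sum_i (\sum_j complex.Re `|M i j|) ^+ 2)) => _ [v /= v1 <-].
  rewrite /l2norm ler_sqrt; last by apply: sumr_ge0 => i _; exact: sqr_ge0.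
  apply: ler_sum => i _; rewrite ler_sqr ?nnegrE; first last.
  - by apply: sumr_ge0 => j _; rewrite -ler0c ReK_norm.
  - by rewrite -ler0c ReK_norm.
  rewrite -lecR ReK_norm rmorph_sum /=.
  apply: le_trans (ler_norm_sum _ _ _) _; apply: ler_sum => j _.
  rewrite ReK_norm normrM ler_piMr // -(@expr_le1 _ 2) // normCK.
  move: v1; rewrite l2norm_le1; apply: le_trans.
  rewrite /ip (bigD1 j) //= mulrC lerDl.
  by apply: sumr_ge0 => k _; rewrite mulrC mul_conjC_ge0.
have unit v : ip v v <= 1 -> ip (mv M v) (mv M v) <= 1.
  rewrite -!l2norm_le1 => v1; apply: le_trans M1.
  by apply: ub_le_sup => //; exists v.
move=> v; have [v0|v0] := eqVneq (ip v v) 0.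
  rewrite (ip_eq0 v0) (_ : mv M 0 = 0); last first.
    by apply/funext => i; rewrite /mv big1 // => j _; rewrite mulr0.
  by [].
have vp : 0 < ip v v by rewrite lt_def v0 ip_ge0.
pose r := sqrtC (ip v v); have r0 : 0 < r by rewrite sqrtC_gt0.
have rr : r ^+ 2 = ip v v by rewrite sqrtCK.
have rc : (r^-1)^* = r^-1 by rewrite (CrealP _) // rpredV ger0_real // ltW.
have := unit (fun i => r^-1 * v i).
rewrite mvZ !ipZl !ipZr rc !mulrA -expr2 exprVn rr mulVf // => /(_ (lexx _)).
by rewrite ler_pdivrMl // mulr1.
Qed.

Lemma tz_contractive (F : {fset G}) psi : lower m [set` F] -> Psi psi ->
  forall v, ip (mv (tz m (fres (F := F) psi)) v) (mv (tz m (fres psi)) v) <= ip v v.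
Proof. by move=> lF P; apply: contractive_of_opnorm; exact: (tf_contractive PsiT). Qed.

Lemma mv_id (I : finType) (u : I -> C) : mv (fun i j => (i == j)%:R) u = u.
Proof.
apply/funext => i; rewrite /mv (bigD1 i) //= eqxx mul1r big1 ?addr0 // => j.
by rewrite eq_sym => /negbTE ->; rewrite mul0r.
Qed.

(** This is [contractive_inv] for the identity kernel. *)
Lemma tz_adj_contractive (F : {fset G}) psi : lower m [set` F] -> Psi psi ->
  forall v, ip (mv (adj (tz m (fres (F := F) psi))) v)
               (mv (adj (tz m (fres psi))) v) <= ip v v.
Proof.
move=> lF P v; pose Id (i j : F) : C := (i == j)%:R.
have pId : posm Id by move=> u; rewrite mv_id; exact: ip_ge0.
have IdId (u : F -> C) : mv Id (mv Id u) = u by rewrite !mv_id.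
have := contractive_inv (T := adj (tz m (fres psi))) pId IdId.
rewrite adjK => /(_ _ v); rewrite !mv_id; apply => u; rewrite !mv_id.
exact: tz_contractive.
Qed.

(* k >= T k T^* as quadratic forms, T the Toeplitz operator of f; that is,
   ([1] - f f^* ) * k is positive (see dominatesE). *)
Definition dominates (F : {fset G}) (k : F -> F -> C) (f : F -> C) :=
  forall u, ip (mv (adj (tz m f)) u) (mv k (mv (adj (tz m f)) u)) <= ip u (mv k u).

Lemma dominatesE (F : {fset G}) (lF : lower m [set` F]) (k : F -> F -> C) f :
  posm (kstar (resm m F) (fun x y => kone R m (val x) (val y) - outer f x y) k)
  <-> dominates k f.
Proof.
have e : kstar (resm m F) (fun x y => kone R m (val x) (val y) - outer f x y) k
       = fun a b => 1 * k a b - mm (tz m f) (mm k (adj (tz m f))) a b.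
  have -> : (fun x y : F => kone R m (val x) (val y) - outer f x y) =
            fun x y => 1 * kone R m (val x) (val y) - outer f x y.
    by apply/funext => x; apply/funext => y; rewrite mul1r.
  by apply/funext => a; apply/funext => b; exact: kstar_defect.
by rewrite e; split=> h u; have := h u; rewrite defect_form mul1r subr_ge0.
Qed.

Lemma kres_kstar (F : {fset G}) (lF : lower m [set` F]) k phi :
  kres (kstar m (fun x y => kone R m x y - outer phi x y) k) =
  kstar (resm m F) (fun x y => kone R m (val x) (val y) - outer (fres phi) x y)
    (kres k).
Proof.
by apply/funext => x; apply/funext => y; rewrite /kres (kstar_res Gsg lF).
Qed.

Lemma K_PsiP (k : G -> G -> C) (F : {fset G}) : lower m [set` F] ->
  K_Psi m Psi k -> posm (kres k : F -> F -> C) /\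
    forall psi, Psi psi -> dominates (kres k : F -> F -> C) (fres psi).
Proof.
move=> lF [pk kp]; split; first exact: pos_kernel_kres.
move=> psi P; apply/(dominatesE lF); rewrite -kres_kstar //.
exact/pos_kernel_kres/kp.
Qed.

(** Restricting the test to lower sets above a prescribed [F0] suits kernels built from data on
    [F0]. *)
Lemma pos_kernel_defect (k : G -> G -> C) phi (F0 : {fset G}) :
  (forall F : {fset G}, lower m [set` F] -> {subset F0 <= F} ->
    dominates (kres k : F -> F -> C) (fres phi)) ->
  pos_kernel (kstar m (fun x y => kone R m x y - outer phi x y) k).
Proof.
move=> h A; have [F lF AF] := lower_hull Gsg (A `|` F0)%fset.
apply: (@pos_kernel_sub _ _ F).
  by move=> x xA; apply: AF; rewrite inE xA.
rewrite kres_kstar //; apply/dominatesE => //; apply: h => // x xF.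
by apply: AF; rewrite inE xF orbT.
Qed.

Lemma K_PsiI (k : G -> G -> C) (F0 : {fset G}) :
  (forall F : {fset G}, lower m [set` F] -> {subset F0 <= F} ->
    posm (kres k : F -> F -> C) /\
    forall psi, Psi psi -> dominates (kres k : F -> F -> C) (fres psi)) ->
  K_Psi m Psi k.
Proof.
move=> h; split.
  move=> A; have [F lF AF] := lower_hull Gsg (A `|` F0)%fset.
  apply: (@pos_kernel_sub _ _ F) => [x xA|].
    by apply: AF; rewrite inE xA.
  by apply: (h F lF _).1 => x xF; apply: AF; rewrite inE xF orbT.
move=> psi P; apply: (@pos_kernel_defect _ _ F0) => F lF F0F.
exact: (h F lF F0F).2.
Qed.

End TestFunctionKernels.

(** * Inverse kernels *)

Section Duality.
Variables (R : realType) (G : choiceType) (m : pmul G) (Gsg : semigroupoid m).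
Local Notation C := R[i].
Variables (Psi : set {ptws G -> C}) (PsiT : test_functions m Psi).

Lemma ge0_eps (x y : C) : 0 <= y -> (forall e, 0 < e -> 0 <= x + e * y) -> 0 <= x.
Proof.
move=> y0 h; apply/ler_addgt0Pr => e e0.
have y1 : 0 < 1 + y by rewrite ltr_pwDl.
apply: le_trans (h (e / (1 + y)) (divr_gt0 e0 y1)) _.
by rewrite lerD2l mulrAC ler_pdivrMr // ler_pM2l // lerDr.
Qed.

(* The condition dual to [dominates]: it is what k >= T k T^* becomes for the
   inverse kernel L = k^-1. *)
Definition codominates (F : {fset G}) (L : F -> F -> C) (f : F -> C) :=
  forall u, ip (mv (tz m f) u) (mv L (mv (tz m f) u)) <= ip u (mv L u).

(* Condition (ii) of the theorem. *)
Definition satisfies_kernels (F : {fset G}) (f : F -> C) :=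
  forall k : G -> G -> C, K_Psi m Psi k -> pos_kernel (kstar (resm m F)
    (fun x y : F => kone R m (val x) (val y) - outer f x y) (kres k)).

Lemma satisfies_kernelsP (F : {fset G}) (f : F -> C) : lower m [set` F] ->
  satisfies_kernels f <->
  forall k, K_Psi m Psi k -> dominates m (kres k : F -> F -> C) f.
Proof.
move=> lF; split=> h k kK.
  by apply/(dominatesE Gsg lF); apply/pos_kernel_fin; exact: h.
by apply/pos_kernel_fin; apply/(dominatesE Gsg lF); exact: h.
Qed.

Lemma mv_eps (I : finType) (M : I -> I -> C) (c : C) u :
  mv (fun x y => M x y + c * (x == y)%:R) u = mv M u + (fun x => c * u x).
Proof.
apply/funext => x; rewrite -[RHS]/(mv M u x + c * u x) /mv.
under eq_bigr do rewrite mulrDl.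
rewrite big_split /=; congr (_ + _); rewrite (bigD1 x) //= eqxx mulr1.
by rewrite big1 ?addr0 // => y; rewrite eq_sym => /negbTE ->; rewrite mulr0 mul0r.
Qed.

(** * Extension of an inverse kernel from F to G *)

Section Extension.
Variables (F : {fset G}) (lF : lower m [set` F]).
Variables (L K' : F -> F -> C) (e : C).
Hypotheses (pL : posm L) (e0 : 0 < e).
Hypothesis LK : forall i l,
  \sum_j (L i j + e * (i == j)%:R) * K' j l = (i == l)%:R.
Hypothesis KL : forall i l,
  \sum_j K' i j * (L j l + e * (j == l)%:R) = (i == l)%:R.

(* The block-diagonal kernel that is K' = (L + e)^-1 on F and e^-1 off F. *)
Definition inv_kernel (x y : G) : C :=
  \sum_(a : F) \sum_(b : F) (val a == x)%:R * (K' a b * (val b == y)%:R)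
  + e^-1 * ((x == y)%:R - \sum_(a : F) (val a == x)%:R * (val a == y)%:R).

Variables (F' : {fset G}) (FF' : {subset F <= F'}).
Let P (a : F) (x : F') : C := (val a == val x)%:R.
Let LE (a b : F) := L a b + e * (a == b)%:R.
Let inc (a : F) : F' := [` FF' (valP a)]%fset.

Lemma restrictE u a : mv P u a = u (inc a).
Proof.
rewrite /mv /P (bigD1 (inc a)) //= eqxx mul1r big1 ?addr0 // => x xa.
rewrite (_ : (_ == _) = false) ?mul0r //; apply/negbTE; apply: contra xa.
by move=> /eqP ax; apply/eqP/val_inj.
Qed.

Lemma restrict_adj u : mv P (mv (adj P) u) = u.
Proof.
apply/funext => a; rewrite restrictE /mv /adj /P (bigD1 a) //= eqxx conjC1 mul1r.
by rewrite big1 ?addr0 // => b ba; rewrite (inj_eq val_inj) (negbTE ba) conjC0 mul0r.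
Qed.

Lemma LE_form v : mv LE v = mv L v + (fun a => e * v a).
Proof. exact: mv_eps. Qed.

Lemma inv_left v : mv K' (mv LE v) = v.
Proof.
rewrite -mv_mm; apply/funext => a; rewrite /mv (bigD1 a) //= big1 => [|b ba].
  by rewrite addr0 /mm KL eqxx mul1r.
by rewrite /mm KL eq_sym (negbTE ba) mul0r.
Qed.

Lemma inv_right v : mv LE (mv K' v) = v.
Proof.
rewrite -mv_mm; apply/funext => a; rewrite /mv (bigD1 a) //= big1 => [|b ba].
  by rewrite addr0 /mm LK eqxx mul1r.
by rewrite /mm LK eq_sym (negbTE ba) mul0r.
Qed.

(** The form L + e on [F], continued by e off [F]. The restricted kernel [KG] is its inverse, so
    properties of [KG] are read off from [LG]. *)
Let LG (x y : F') : C := mm (adj P) (mm L P) x y + e * (x == y)%:R.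
Let KG : F' -> F' -> C := kres inv_kernel.

Lemma LG_form u : ip u (mv LG u) = ip (mv P u) (mv L (mv P u)) + e * ip u u.
Proof. by rewrite /LG mv_eps ipDr ipZr !mv_mm ip_adj adjK. Qed.

Lemma LGE u : mv LG u =
  mv (adj P) (mv LE (mv P u)) + (fun x => e * (u - mv (adj P) (mv P u)) x).
Proof.
rewrite /LG mv_eps !mv_mm LE_form mvD -addrA; congr (_ + _).
rewrite mvZ; apply/funext => x.
rewrite -[RHS]/(e * mv (adj P) (mv P u) x + e * (u x - mv (adj P) (mv P u) x)).
by ring.
Qed.

Lemma KGE u : mv KG u =
  mv (adj P) (mv K' (mv P u)) + (fun x => e^-1 * (u - mv (adj P) (mv P u)) x).
Proof.
apply/funext => x.
rewrite -[RHS]/(mv (adj P) (mv K' (mv P u)) x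
  + e^-1 * (u x - mv (adj P) (mv P u) x)).
rewrite -(mv_mm K') -!(mv_mm (adj P)) -[u x](congr1 (fun g => g x) (mv_id u)).
rewrite /mv -sumrB mulr_sumr -big_split; apply: eq_bigr => y _ /=.
rewrite /KG /kres /inv_kernel mulrDl; congr (_ * _ + _).
  rewrite /mm; apply: eq_bigr => a _. rewrite mulr_sumr; apply: eq_bigr => b _.
  by rewrite /adj /P conjC_nat.
rewrite -mulrA mulrBl; congr (_ * (_ - _ * _)).
by rewrite /mm; apply: eq_bigr => a _; rewrite /adj /P conjC_nat.
Qed.

Lemma LG_inv_left u : mv KG (mv LG u) = u.
Proof.
have PLG : mv P (mv LG u) = mv LE (mv P u).
  rewrite LGE mvD restrict_adj mvZ mvD mvN restrict_adj subrr.
  by apply/funext => a; rewrite -[LHS]/(_ + e * 0) mulr0 addr0.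
rewrite KGE PLG inv_left LGE; apply/funext => x.
set A := mv (adj P) (mv LE _); set B := mv (adj P) (mv P u).
rewrite -[LHS]/(B x + e^-1 * (A x + e * (u x - B x) - A x)).
by field; rewrite gt_eqF.
Qed.

Lemma LG_inv_right u : mv LG (mv KG u) = u.
Proof.
have PKG : mv P (mv KG u) = mv K' (mv P u).
  rewrite KGE mvD restrict_adj mvZ mvD mvN restrict_adj subrr.
  by apply/funext => a; rewrite -[LHS]/(_ + e^-1 * 0) mulr0 addr0.
rewrite LGE PKG inv_right KGE; apply/funext => x.
set A := mv (adj P) (mv K' _); set B := mv (adj P) (mv P u).
rewrite -[LHS]/(B x + e * (A x + e^-1 * (u x - B x) - A x)).
by field; rewrite gt_eqF.
Qed.

Lemma LG_pos : posm LG.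
Proof. by move=> u; rewrite LG_form addr_ge0 // mulr_ge0 ?ip_ge0 // ltW. Qed.

Lemma KG_pos : posm KG.
Proof.
move=> u; rewrite -{1}(LG_inv_right u) -(ip_herm _ _ (posm_herm LG_pos)).
exact: LG_pos.
Qed.

(** Restriction P to a lower set intertwines the Toeplitz operators, P T' = T P. The defect of [LG]
    thus splits into that of L, nonnegative by assumption, and e (1 - T'^* T'), nonnegative by
    contractivity. *)
Lemma KG_dominates psi : lower m [set` F'] -> Psi psi ->
  codominates L (fres psi) -> dominates m KG (fres psi).
Proof.
move=> lF' Ppsi LT; pose T := tz m (fres (F := F') psi).
have TP u : mv P (mv T u) = mv (tz m (fres psi)) (mv P u).
  (* Extending u by zero makes both Toeplitz operators restrictions of one convolution on [G]. *)
  pose v (x : G) : C := \sum_(y : F') (x == val y)%:R * u y.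
  have uE : u = fres v.
    apply/funext => y; rewrite /fres /= /v (bigD1 y) //= eqxx mul1r big1 ?addr0 //.
    move=> z zy; rewrite (inj_eq val_inj) eq_sym (negbTE zy) mul0r //.
  rewrite -[mv P u]/(fres v) (fres_star Gsg lF) /T [in LHS]uE (fres_star Gsg lF').
  by apply/funext => a; rewrite restrictE.
have := contractive_inv (T := adj T) LG_pos LG_inv_right.
rewrite adjK; apply => u; rewrite !LG_form TP; apply: lerD; first exact: LT.
by rewrite ler_pM2l //; exact: (tz_contractive PsiT).
Qed.

End Extension.

Lemma inv_kernel_K_Psi (F : {fset G}) (L K' : F -> F -> C) e :
  lower m [set` F] -> posm L -> 0 < e ->
  (forall i l, \sum_j (L i j + e * (i == j)%:R) * K' j l = (i == l)%:R) ->
  (forall psi, Psi psi -> codominates L (fres psi)) ->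
  K_Psi m Psi (inv_kernel K' e).
Proof.
move=> lF pL e0 LK LT; apply: (K_PsiI Gsg (F0 := F)) => F' lF' FF'; split.
  exact: (KG_pos pL e0 LK FF').
by move=> psi P; exact: (KG_dominates lF pL e0 LK FF' lF' P (LT _ P)).
Qed.

(** Since L may be singular, (ii) is applied to the kernel of (L + e)^-1; inverting back costs at
    most e <u, u>, which vanishes with e. *)
Lemma codominates_of_kernels (F : {fset G}) (lF : lower m [set` F])
    (f : F -> C) (L : F -> F -> C) :
  satisfies_kernels f -> posm L ->
  (forall psi, Psi psi -> codominates L (fres psi)) -> codominates L f.
Proof.
move=> /(satisfies_kernelsP _ lF) fk pL LT u; rewrite -subr_ge0.
apply: (@ge0_eps _ (ip u u)); first exact: ip_ge0.
move=> e e0; have [K' [LK KL]] := regularized_inv pL e0.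
have FF : {subset F <= F} by [].
have := fk _ (inv_kernel_K_Psi lF pL e0 LK LT).
move=> /(contractive_inv (KG_pos pL e0 LK FF)).
move=> /(_ _ (LG_inv_left e0 KL FF) u).
have PE (v : F -> C) : mv (fun a b : F => (val a == val b)%:R) v = v.
  by rewrite -[RHS]mv_id; congr mv.
rewrite !LG_form !PE -subr_ge0 => h; apply: le_trans h _.
rewrite opprD addrACA lerD2l lerBlDr lerDl.
by rewrite mulr_ge0 ?ip_ge0 // ltW.
Qed.

(** The norm is an infimum, so only constants c < 1 + r are at hand; r <= 1 gives c^2 <= 1 + 3 r,
    the source of the factor 3. *)
Lemma Hinf_satisfies_kernels (F : {fset G}) (lF : lower m [set` F]) phi :
  Hinf m Psi phi -> Hinf_norm m Psi phi <= 1 -> satisfies_kernels (fres (F := F) phi).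
Proof.
move=> hphi nphi; apply/(satisfies_kernelsP _ lF) => k kK u.
set K := kres k; have [pK _] := K_PsiP Gsg lF kK.
rewrite -subr_ge0; apply: (@ge0_eps _ (3 * ip u (mv K u))).
  by rewrite mulr_ge0.
move=> e e0.
have [r [r0 r1 re]] : exists r : R, [/\ 0 < r, r <= 1 & r%:C%C <= e].
  exists (Num.min 1 (complex.Re e)); rewrite lt_min ltr01 /=.
  have eE : (complex.Re e)%:C%C = e by rewrite RRe_real // gtr0_real.
  by split; rewrite ?ge_min ?lexx // -?ltcR ?eE // -[leRHS]eE lecR ge_min lexx orbT.
have hinf : has_inf (Hinf_bound m Psi phi).
  by split=> //; exists 0 => c [/ltW].
have [c [c0 ck] cr] := inf_adherent r0 hinf.
have c1 : c < 1 + r by apply: lt_le_trans cr _; rewrite lerD2r.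
have c3 : c ^+ 2 <= 1 + 3 * r by nra.
have := pos_kernel_kres (F := F) (ck k kK) u.
have -> : kres (kstar m (fun x y => (c ^+ 2)%:C%C * kone R m x y - outer phi x y) k)
    = fun a b : F => (c ^+ 2)%:C%C * K a b
        - mm (tz m (fres phi)) (mm K (adj (tz m (fres phi)))) a b.
  apply/funext => a; apply/funext => b; rewrite /kres (kstar_res Gsg lF).
  exact: (kstar_defect Gsg lF).
rewrite defect_form => h; apply: le_trans h _.
rewrite addrAC lerD2r -[X in _ <= X + _]mul1r mulrA -mulrDl.
apply: ler_wpM2r; first exact: pK.
apply: le_trans (_ : (1 + 3 * r)%:C%C <= _); first by rewrite lecR.
by rewrite rmorphD rmorphM /= rmorph_nat lerD2l mulrC ler_wpM2r.
Qed.

End Duality.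

(** * Weighted norms *)

Section RealNorm.
Variable R : realType.
Local Notation C := R[i].

Definition nm (z : C) : R := complex.Re `|z|.

Lemma nmE z : (nm z)%:C%C = `|z|.
Proof. exact: ReK_norm. Qed.

Lemma nm_ge0 z : 0 <= nm z.
Proof. by rewrite -ler0c nmE. Qed.

Lemma nmD x y : nm (x + y) <= nm x + nm y.
Proof. by rewrite -lecR rmorphD /= !nmE ler_normD. Qed.

Lemma nmM x y : nm (x * y) = nm x * nm y.
Proof. by apply: complexI; rewrite rmorphM /= !nmE normrM. Qed.

Lemma nm_sum (I : Type) (r : seq I) (P : pred I) (F : I -> C) :
  nm (\sum_(i <- r | P i) F i) <= \sum_(i <- r | P i) nm (F i).
Proof.
rewrite -lecR rmorph_sum /= nmE; apply: le_trans (ler_norm_sum _ _ _) _.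
by apply: ler_sum => i _; rewrite nmE.
Qed.

Lemma nm_sqr z : (nm z ^+ 2)%:C%C = z^* * z.
Proof. by rewrite rmorphXn /= nmE normCK mulrC. Qed.

Lemma Re_le_nm z : - nm z <= complex.Re z.
Proof.
case: z => a b; rewrite /nm normc_def /= lerNl.
apply: le_trans (ler_norm _) _; rewrite normrN -sqrtr_sqr ler_wsqrtr //.
by rewrite lerDl sqr_ge0.
Qed.

Lemma sum_sqr_le (I : finType) (P : pred I) (x : I -> R) :
  (\sum_(i | P i) x i) ^+ 2 <= #|I|%:R * \sum_(i | P i) x i ^+ 2.
Proof.
rewrite big_mkcond [X in _ <= _ * X]big_mkcond /=.
set y := fun i => if P i then x i else 0.
have -> : \sum_i (if P i then x i ^+ 2 else 0) = \sum_i y i ^+ 2.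
  by apply: eq_bigr => i _; rewrite /y; case: ifP => // _; rewrite expr0n.
have e1 : #|I|%:R * \sum_i y i ^+ 2 = \sum_i \sum_j (y i ^+ 2 + y j ^+ 2) / 2.
  under [RHS]eq_bigr => i _ do
    rewrite -mulr_suml big_split /= sumr_const -[y i ^+ 2 *+ _]mulr_natl.
  rewrite -mulr_suml big_split /= -mulr_sumr sumr_const.
  by rewrite -[_ *+ _]mulr_natl; field.
rewrite e1 expr2 mulr_suml; apply: ler_sum => i _; rewrite mulr_sumr.
apply: ler_sum => j _.
by rewrite -[leLHS]/(y i * y j); have := sqr_ge0 (y i - y j); nra.
Qed.

Lemma ge0_geometric (x y rho : R) : 0 <= rho -> rho < 1 -> 0 <= y ->
  (forall n, 0 <= x + rho ^+ n * y) -> 0 <= x.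
Proof.
move=> r0 r1 y0 h.
have cv : (fun n => x + rho ^+ n * y) @ \oo --> x + 0 * y.
  apply: cvgD; first exact: cvg_cst.
  by apply: cvgMr_tmp; apply: cvg_expr; rewrite ger0_norm.
rewrite mul0r addr0 in cv.
by apply: (cvgr_to_ge cv); apply: nearW => n; exact: h.
Qed.

End RealNorm.

Section Weights.
Variables (R : realType) (G : choiceType) (m : pmul G) (Gsg : semigroupoid m).
Local Notation C := R[i].
Variables (Psi : set {ptws G -> C}) (PsiT : test_functions m Psi).
Variables (F : {fset G}) (lF : lower m [set` F]).
Local Notation mF := (resm m F).
Local Notation T psi := (tz m (fres (F := F) psi)).

(** For f the right unit of p, psi(p) is an entry in column f of a contractive Toeplitz matrix. *)
Lemma test_le1 psi (p : F) : Psi psi -> nm (psi (val p)) <= 1.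
Proof.
move=> P; have [e [f [_ fi _ pf]]] := sg_unit Gsg (val p).
have fF : f \in F by case: (lower_factors Gsg lF pf (valP p)).
pose u (x : F) : C := (x == [` fF]%fset)%:R.
have Tu : mv (T psi) u p = psi (val p).
  rewrite /u mv_delta /tz /toeplitz (big_pred1 p) // => c /=.
  apply/eqP/eqP => [/resmP /= cf|->]; last exact/resmP.
  by apply: val_inj; have := fi.2 _ _ cf.
have := tz_contractive PsiT lF P u.
rewrite {2}/ip (bigD1 [` fF]%fset) //= /u eqxx conjC1 mulr1 big1 ?addr0; last first.
  by move=> x /negbTE ->; rewrite mulr0.
rewrite /ip (bigD1 p) //= -/u Tu -nm_sqr => h.
rewrite -(@expr_le1 _ 2) ?nm_ge0 // -lecR; apply: le_trans h.
by rewrite lerDl sumr_ge0 // => x _; rewrite mulrC mul_conjC_ge0.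
Qed.

Lemma bernoulli_le (t : R) n : 0 <= t <= 1 -> 1 - n%:R * t <= (1 - t) ^+ n.
Proof.
move=> /andP[t0 t1]; elim: n => [|n IH]; first by rewrite expr0 mul0r subr0.
rewrite exprS -natr1; apply: le_trans (_ : (1 - t) * (1 - n%:R * t) <= _).
  have : 0 <= n%:R :> R by []. nra.
by rewrite ler_wpM2l // subr_ge0.
Qed.

(** Uniform convergence yields one n with |psi(e)|^(n+1) < 1/2 for all psi. By Bernoulli's
    inequality |psi(e)| <= 1 - t with t = 1 / (2 (n + 1)), and [F] has finitely many idempotents. *)
Lemma test_idem_lt1 : exists2 r : R, 0 <= r < 1 &
  forall psi (e : F), Psi psi -> idem m (val e) -> nm (psi (val e)) <= r.
Proof.
have one (e : F) : exists r : R, 0 <= r < 1 /\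
    forall psi, Psi psi -> idem m (val e) -> nm (psi (val e)) <= r.
  have [ie|nie] := pselect (idem m (val e)); last first.
    by exists 0; rewrite lexx ltr01.
  pose P : set ({ptws G -> C} -> C) := [set h | forall psi, Psi psi ->
    ball (0 : C) (1 / 2%:R) (h psi)].
  have nP : nbhs ((fun=> 0) : {uniform` Psi -> C}) P.
    apply/uniform_nbhs; exists [set xy | ball xy.1 (1 / 2%:R) xy.2]; split.
      by rewrite -entourage_ballE; exists (1 / 2%:R); rewrite //= divr_gt0.
    by move=> h /= hP psi Ppsi; exact: hP.
  have /(_ P nP) [n _ hn] := tf_idem PsiT ie.
  pose t : R := (2 * n.+1%:R)^-1.
  have nt : n.+1%:R * t = 1 / 2.
    by rewrite /t invfM mulrCA mulfV ?pnatr_eq0 // mulr1 div1r.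
  have t1 : 0 <= t <= 1.
    rewrite invr_ge0 mulr_ge0 //= invf_le1 ?mulr_gt0 //.
    have : 1 <= n.+1%:R :> R by rewrite ler1n.
    by lra.
  have t0 : 0 < t by rewrite invr_gt0 mulr_gt0.
  exists (1 - t); split; first by move: t1 => /andP[? ?]; apply/andP; split; lra.
  move=> psi Ppsi _; have := hn n.+1 (leqnSn n) psi Ppsi.
  rewrite -ball_normE /= sub0r normrN normrX -nmE => h.
  have {}h : nm (psi (val e)) ^+ n.+1 < 1 / 2.
    by rewrite -ltcR rmorphXn /= fmorph_div rmorph1 rmorph_nat.
  rewrite leNgt; apply/negP => lt; have := bernoulli_le n.+1 t1.
  rewrite nt => b; move: h; apply/negP; rewrite -leNgt.
  apply: le_trans (_ : (1 - t) ^+ n.+1 <= _); first by apply: le_trans b; lra.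
  by rewrite lerXn2r ?nnegrE ?nm_ge0 ?(ltW lt) // subr_ge0; case/andP: t1.
have [r hr] := choice one; exists (\big[Num.max/0]_e r e).
  apply/andP; split; first by apply: bigmax_ge_id.
  by apply: bigmax_lt => // e _; case: (hr e) => /andP[].
move=> psi e Ppsi ie; apply: le_trans ((hr e).2 psi Ppsi ie) _.
exact: le_bigmax.
Qed.

Definition wnorm (d : F -> R) (h : F -> C) : R := \sum_a d a * nm (h a) ^+ 2.

(* The weights d a = eta ^ rank a decrease so fast that the strictly lower
   triangular part of the Toeplitz operators is negligible; its diagonal part
   consists of values of psi at idempotents. *)
Lemma weights : exists (d : F -> R) (rho : R),
  [/\ 0 <= rho < 1, forall a, 0 < d a &
      forall psi h, Psi psi -> wnorm d (mv (T psi) h) <= rho * wnorm d h].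
Proof.
have [r /andP[r0 r1] hr] := test_idem_lt1.
pose n : R := #|{: F}|%:R; have n0 : 0 <= n by [].
have r1' : 0 < 1 - r by rewrite subr_gt0.
(* Entries of T_psi are sums of at most n values of modulus at most 1; squaring gives n^2,
   Cauchy-Schwarz one more n, and the convexity estimate below the division by 1 - r. *)
have [kap kapE kap0] : exists2 kap, kap = n ^+ 3 / (1 - r) & 0 <= kap.
  by exists (n ^+ 3 / (1 - r)) => //; rewrite divr_ge0 ?(ltW r1') // exprn_ge0.
(* Chosen so that eta kap n <= (1 - r) / 2, which leaves rho = r + (1 - r) / 2. *)
pose eta := (1 - r) / (2 * (kap * n + 1)).
have kn0 : 0 < kap * n + 1 by rewrite ltr_wpDl // mulr_ge0.
have eta0 : 0 < eta by rewrite divr_gt0 // mulr_gt0.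
have eta1 : eta <= 1.
  by rewrite ler_pdivrMr ?mulr_gt0 // mul1r; have := mulr_ge0 kap0 n0; lra.
have etak : eta * (kap * n) <= (1 - r) / 2.
  rewrite /eta invfM -!mulrA ler_wpM2l ?(ltW r1') // ler_piMr ?invr_ge0 //.
  by rewrite mulrC ler_pdivrMr // mul1r lerDl.
pose rk (a : F) := rank m (val a).
pose d a := eta ^+ rk a.
have d0 a : 0 < d a by rewrite exprn_gt0.
have dlt a b : (rk a < rk b)%N -> d b <= eta * d a.
  move=> ab; rewrite /d -exprS -(subnK ab) exprD ler_piMl ?exprn_ge0 ?(ltW eta0) //.
  by rewrite exprn_ile1 // (ltW eta0).
have pt psi h a : Psi psi -> nm (mv (T psi) h a) ^+ 2 <=
    r * nm (h a) ^+ 2 + kap * \sum_(q | (rk q < rk a)%N) nm (h q) ^+ 2.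
  move=> P; pose Y := n * \sum_(q | (rk q < rk a)%N) nm (h q).
  have le1 : nm (mv (T psi) h a) <= r * nm (h a) + Y.
    rewrite /mv (bigD1 a) //=; apply: le_trans (nmD _ _) _; apply: lerD.
      rewrite nmM ler_wpM2r ?nm_ge0 //.
      have uP := lunitP Gsg (val a).
      have uF : lunit Gsg (val a) \in F by case: (lower_factors Gsg lF uP (valP a)).
      rewrite /tz /toeplitz (big_pred1 [` uF]%fset); last first.
        move=> c /=; apply/eqP/eqP => [/resmP ca|->]; last exact/resmP.
        by apply: val_inj; exact: lunit_uniq ca.
      by apply: hr => //; exact: lunit_idem.
    apply: le_trans (nm_sum _ _ _) _; rewrite /Y mulr_sumr.
    rewrite big_mkcond [leRHS]big_mkcond; apply: ler_sum => q _ /=.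
    case: ifP => [qa|_]; last by case: ifP => // _; rewrite mulr_ge0 ?nm_ge0.
    have [c cq|no] := pickP (fun c => mF c q == Some a); last first.
      rewrite /tz /toeplitz big1; last by move=> c; rewrite no.
      rewrite mul0r /nm normr0.
      by case: ifP => // _; rewrite mulr_ge0 ?nm_ge0.
    have lt : (rk q < rk a)%N.
      apply: (rank_lt Gsg); first by move/eqP/resmP: cq; exact.
      by rewrite (inj_eq val_inj).
    rewrite lt nmM ler_wpM2r ?nm_ge0 //; apply: le_trans (nm_sum _ _ _) _.
    apply: le_trans (ler_sum _ (fun c _ => test_le1 c P)) _.
    by rewrite sumr_const ler_nat max_card.
  have Y2 : Y ^+ 2 <= n ^+ 3 * \sum_(q | (rk q < rk a)%N) nm (h q) ^+ 2.
    by rewrite exprMn (exprSr n 2) -mulrA ler_wpM2l ?exprn_ge0 // sum_sqr_le.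
  have x0 := nm_ge0 (h a); have z0 := nm_ge0 (mv (T psi) h a).
  apply: le_trans (_ : r * nm (h a) ^+ 2 + Y ^+ 2 / (1 - r) <= _); last first.
    by rewrite lerD2l kapE [leRHS]mulrAC ler_wpM2r // invr_ge0 ltW.
  have Y0 : 0 <= Y by rewrite mulr_ge0 // sumr_ge0 // => q _; exact: nm_ge0.
  apply: le_trans (_ : (r * nm (h a) + Y) ^+ 2 <= _).
    by rewrite ler_sqr ?nnegrE // addr_ge0 // mulr_ge0.
  (* Convexity of the square: (r x + (1 - r) w)^2 <= r x^2 + (1 - r) w^2 with w = y / (1 - r). *)
  move: (nm (h a)) x0 Y0 {Y2 le1} => x x0; move: Y => y y0.
  have -> : y = (1 - r) * (y / (1 - r)) by field; rewrite gt_eqF.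
  set w := y / (1 - r).
  have -> : ((1 - r) * w) ^+ 2 / (1 - r) = (1 - r) * w ^+ 2.
    by field; rewrite gt_eqF.
  have := mulr_ge0 (mulr_ge0 r0 (ltW r1')) (sqr_ge0 (x - w)); nra.
exists d, ((1 + r) / 2); split=> //; first by apply/andP; split; lra.
move=> psi h P; rewrite /wnorm.
apply: le_trans (ler_sum _ (fun a _ => ler_wpM2l (ltW (d0 a)) (pt psi h a P))) _.
under eq_bigr do rewrite mulrDr.
rewrite big_split /=.
have -> : \sum_a d a * (kap * \sum_(q | (rk q < rk a)%N) nm (h q) ^+ 2) =
    \sum_q nm (h q) ^+ 2 * (kap * \sum_(a | (rk q < rk a)%N) d a).
  under eq_bigr do rewrite mulrA mulr_sumr big_mkcond.
  rewrite exchange_big; apply: eq_bigr => q _; rewrite -big_mkcond /= !mulr_sumr.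
  by apply: eq_bigr => a _; ring.
rewrite -big_split /= mulr_sumr; apply: ler_sum => q _.
have S : kap * \sum_(a | (rk q < rk a)%N) d a <= (1 - r) / 2 * d q.
  apply: le_trans (_ : eta * (kap * n) * d q <= _); last by rewrite ler_wpM2r // ltW.
  rewrite (_ : _ * d q = kap * (n * (eta * d q))); last by ring.
  rewrite ler_wpM2l //; apply: le_trans (ler_sum _ (fun a => @dlt q a)) _.
  rewrite sumr_const -mulr_natl (ler_wpM2r (mulr_ge0 (ltW eta0) (ltW (d0 q)))) //.
  by rewrite ler_nat max_card.
have x0 := sqr_ge0 (nm (h q)); have := ler_wpM2l x0 S.
lra.
Qed.

(** For one fixed T = T_psi, iteration gives <u, L u> >= <T^n u, L T^n u>, and the right-hand side
    is at least - c rho^n [wnorm d u], with c depending only on L and the weights. *)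
Lemma pos_of_codominates (L : F -> F -> C) :
  herm L -> (forall psi, Psi psi -> codominates m L (fres psi)) -> posm L.
Proof.
move=> hL LT; have [psi Ppsi] := tf_nonempty PsiT.
have [d [rho [/andP[rho0 rho1] d0 dT]]] := weights.
pose B := \sum_a \sum_b nm (L a b).
pose c := B * \sum_a (d a)^-1.
have B0 : 0 <= B by do 2 (apply: sumr_ge0 => ? _); exact: nm_ge0.
have c0 : 0 <= c.
  by rewrite mulr_ge0 // sumr_ge0 // => a _; rewrite invr_ge0 ltW.
have w0 v : 0 <= wnorm d v.
  by apply: sumr_ge0 => a _; rewrite mulr_ge0 ?sqr_ge0 // ltW.
have realL v : (complex.Re (ip v (mv L v)))%:C%C = ip v (mv L v).
  by rewrite RRe_real //; apply/CrealP; rewrite ipC (ip_herm _ _ hL).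
pose W v := (\sum_a (d a)^-1) * wnorm d v.
have sq_le v a : nm (v a) ^+ 2 <= W v.
  apply: le_trans (_ : (d a)^-1 * wnorm d v <= _); last first.
    rewrite ler_wpM2r // (bigD1 a) //= lerDl sumr_ge0 // => b _.
    by rewrite invr_ge0 ltW.
  rewrite ler_pdivlMl // /wnorm (bigD1 a) //= lerDl sumr_ge0 // => b _.
  by rewrite mulr_ge0 ?sqr_ge0 // ltW.
have low v : - (c * wnorm d v) <= complex.Re (ip v (mv L v)).
  apply: le_trans (Re_le_nm _); rewrite lerN2 /c -mulrA -/(W v) /B mulr_suml.
  apply: le_trans (nm_sum _ _ _) _; apply: ler_sum => a _; rewrite mulr_suml nmM.
  apply: le_trans (ler_wpM2l (nm_ge0 _) (nm_sum _ _ _)) _; rewrite mulr_sumr.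
  apply: ler_sum => b _; rewrite nmM mulrCA ler_wpM2l ?nm_ge0 //.
  rewrite [nm _^*](_ : _ = nm (v a)); last by rewrite /nm norm_conjC.
  have := sq_le v a; have := sq_le v b; have := sqr_ge0 (nm (v a) - nm (v b)); nra.
move=> u; rewrite -realL ler0c.
apply: (ge0_geometric rho0 rho1 (mulr_ge0 c0 (w0 u))) => n.
rewrite mulrCA -lerBlDr sub0r.
have : rho ^+ n * wnorm d u >= wnorm d (iter n (mv (T psi)) u).
  elim: n => [|n IH]; first by rewrite expr0 mul1r.
  apply: le_trans (dT _ _ Ppsi) _; rewrite exprS -mulrA ler_wpM2l //.
have : complex.Re (ip (iter n (mv (T psi)) u) (mv L (iter n (mv (T psi)) u)))
    <= complex.Re (ip u (mv L u)).
  elim: n => [//|n IH]; apply: le_trans IH; rewrite -lecR !realL /=.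
  exact: LT.
move=> h1 h2; apply: le_trans h1; apply: le_trans (low _).
by rewrite lerN2 ler_wpM2l.
Qed.

End Weights.

(** * The cone of finite representations *)

Section Caratheodory.
Variable R : realType.

(** One vector more than the dimension yields a linear relation c; moving along it from the
    coefficients 1 until one of them reaches 0 preserves the sum. *)
Lemma caratheodory (J : finType) (s : 'I_#|J|.+1 -> J -> R) :
  exists t : 'I_#|J|.+1 -> R, [/\ forall i, 0 <= t i, exists i, t i = 0 &
    forall j, \sum_i t i * s i j = \sum_i s i j].
Proof.
pose A : 'M[R]_(#|J|.+1, #|J|) := \matrix_(i, k) s i (enum_val k).
have [c c0 cA] : exists2 c : 'rV[R]_#|J|.+1, c != 0 & c *m A = 0.
  have : kermx A != 0.
    by rewrite kermx_eq0 /row_free ltn_eqF // ltnS rank_leq_col.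
  by case/rowV0Pn => c /sub_kermxP cA c0; exists c.
have cs j : \sum_i c 0 i * s i j = 0.
  have := congr1 (fun B : 'rV[R]_#|J| => B 0 (enum_rank j)) cA.
  rewrite !mxE; apply: etrans; apply: eq_bigr => i _.
  by rewrite mxE enum_rankK.
(* Up to replacing c by -c the maximal entry c_k is positive, so every 1 - c_i / c_k is
   nonnegative. *)
wlog [i ci] : c c0 {cA} cs / exists i, 0 < c 0 i.
  move=> hw; have [i0 /negbTE ci0] : exists i, c 0 i != 0.
    apply: contrapT => /forallNP h; case/negP: c0; apply/eqP/rowP => i.
    by rewrite mxE; apply/eqP/negPn/negP => /h.
  have [ci|ci] := ltP 0 (c 0 i0); first by apply: (hw c) => //; exists i0.
  apply: (hw (- c)); rewrite ?oppr_eq0 //.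
    by move=> j; under eq_bigr do rewrite mxE mulNr; rewrite sumrN cs oppr0.
  by exists i0; rewrite mxE oppr_gt0 lt_neqAle ci0.
have [k _ ck] := Order.TotalTheory.arg_maxP (fun i => c 0 i) (erefl (predT i)).
have ck0 : 0 < c 0 k := lt_le_trans ci (ck i erefl).
exists (fun i => 1 - c 0 i / c 0 k); split.
- by move=> j; rewrite subr_ge0 ler_pdivrMr // mul1r; exact: ck.
- by exists k; rewrite divff ?gt_eqF // subrr.
move=> j; under eq_bigr do rewrite mulrBl mul1r mulrAC.
by rewrite sumrB -mulr_suml cs mul0r subr0.
Qed.

End Caratheodory.

(** * Continuity of complex-valued maps *)

Section ContinuityTools.
Variables (R : realType) (X : topologicalType).
Local Notation C := R[i].

Lemma continuous_sum (K : numFieldType) (V : normedModType K) (I : Type)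
    (r : seq I) (P : pred I) (F : I -> X -> V) :
  (forall i, continuous (F i)) ->
  continuous (fun x => \sum_(i <- r | P i) F i x).
Proof.
move=> cF x; elim: r => [|i r IH].
  rewrite (_ : (fun _ => _) = cst 0); first exact: cvg_cst.
  by apply/funext => y; rewrite big_nil.
case Pi : (P i); last first.
  rewrite (_ : (fun _ => _) = fun y => \sum_(j <- r | P j) F j y) //.
  by apply/funext => y; rewrite big_cons Pi.
rewrite (_ : (fun _ => _) = F i \+ (fun y => \sum_(j <- r | P j) F j y)).
  by apply: cvgD => //; exact: cF.
by apply/funext => y; rewrite big_cons Pi.
Qed.

Lemma continuous_mulc (f g : X -> C) :
  continuous f -> continuous g -> continuous (fun x => f x * g x).
Proof. by move=> cf cg x; apply: (@cvgM R[i]); [exact: cf|exact: cg]. Qed.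

Lemma continuous_cstc (c : C) : continuous (fun _ : X => c).
Proof. by move=> x; exact: cvg_cst. Qed.

Lemma continuous_subc (f g : X -> C) :
  continuous f -> continuous g -> continuous (fun x => f x - g x).
Proof. by move=> cf cg x; apply: cvgB; [exact: cf|exact: cg]. Qed.

Lemma continuous_lipschitz1 (f : C -> C) :
  (forall x y, `|f x - f y| <= `|x - y|) -> continuous f.
Proof.
move=> lf x; have FF : Filter (nbhs (x : C)) by exact: nbhs_filter.
apply: (proj2 (cvgrPdist_lt (F := nbhs (x : C)) _ _)) => e e0.
apply: filterS (nbhsx_ballx (x : C^o) _ e0) => y.
by rewrite -ball_normE /=; apply: le_lt_trans; exact: lf.
Qed.

Lemma continuous_conjc (f : X -> C) :
  continuous f -> continuous (fun x => (f x)^*).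
Proof.
move=> cf x; apply: (@continuous_comp _ _ _ f (fun z : C => z^*)); first exact: cf.
by apply: continuous_lipschitz1 => a b; rewrite -rmorphB norm_conjC.
Qed.

Lemma continuous_complex (f g : X -> R) : continuous f -> continuous g ->
  continuous (fun x => Complex (f x) (g x) : C).
Proof.
move=> cf cg.
have cofR (h : X -> R) : continuous h -> continuous (fun x => (h x)%:C%C : C).
  move=> ch x; apply/cvgrPdist_lt => e e0.
  have eE : (complex.Re e)%:C%C = e by rewrite RRe_real // gtr0_real.
  have e0' : 0 < complex.Re e by rewrite -ltcR eE.
  move/cvgrPdist_lt: (ch x) => /(_ _ e0'); apply: filterS => y.
  by rewrite -ltcR eE -rmorphB normc_def /= expr0n addr0 sqrtr_sqr.
have -> : (fun x => Complex (f x) (g x)) = fun x => (f x)%:C%C + 'i%C * (g x)%:C%C.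
  by apply/funext => x; rewrite {1}[Complex _ _]complexE.
move=> x; apply: cvgD; first exact: cofR.
by apply: (@cvgM R[i]); [exact: cvg_cst|exact: cofR].
Qed.

Lemma continuous_nm_sqr (f : X -> C) :
  continuous f -> continuous (fun x => nm (f x) ^+ 2).
Proof.
move=> cf; have cn : continuous (fun x => nm (f x)).
  move=> x; apply: (@continuous_comp _ _ _ f (fun z : C => nm z)); first exact: cf.
  exact: Re_norm_continuous.
by move=> x; apply: cvgM; exact: cn.
Qed.

End ContinuityTools.

(** * The closed cone and its point nearest to the target kernel *)

Section FiniteRepresentation.
Variables (R : realType) (G : choiceType) (m : pmul G) (Gsg : semigroupoid m).
Local Notation C := R[i].
Variables (Psi : set {ptws G -> C}) (PsiT : test_functions m Psi).
Variables (F : {fset G}) (lF : lower m [set` F]).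
Local Notation mF := (resm m F).
Local Notation T psi := (tz m (fres (F := F) psi)).

Definition rank1 (u : F -> C) (p : F * F) : C := u p.1 * (u p.2)^*.

Definition sterm (psi : G -> C) (h : F -> C) : F * F -> C :=
  rank1 h - rank1 (mv (T psi) h).

(** Condition (iii) for a Gamma that is a finite sum of rank-one kernels of the h_i, each carried by
    the point evaluation at psi_i. *)
Definition finrep (f : F -> C) := exists N (psi : 'I_N -> G -> C)
    (h : 'I_N -> F -> C), (forall i, Psi (psi i)) /\
  forall p, rank1 (idf R m val) p - rank1 f p
    = \sum_i sterm (psi i) (h i) p.

Lemma conjcR (t : R) : (t%:C%C : C)^* = t%:C%C.
Proof. by apply/CrealP/complex_realP; exists t. Qed.

Lemma rank1Z (t : R) u p : 0 <= t ->
  rank1 (fun x => (Num.sqrt t)%:C%C * u x) p = t%:C%C * rank1 u p.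
Proof.
move=> t0; rewrite /rank1 rmorphM /= conjcR -[in RHS](sqr_sqrtr t0) rmorphXn /=.
by rewrite expr2; ring.
Qed.

Lemma stermZ psi h (t : R) p : 0 <= t ->
  sterm psi (fun x => (Num.sqrt t)%:C%C * h x) p = t%:C%C * sterm psi h p.
Proof.
move=> t0; rewrite /sterm mvZ.
by rewrite -[LHS]/(rank1 _ p - rank1 _ p) !rank1Z // -mulrBr.
Qed.

(* By Caratheodory's theorem, the kernels that are sums of this many terms
   form a convex cone. *)
Definition nterm : nat := #|{: F * F * bool}|.

Definition ksum N (psi : 'I_N -> G -> C) (h : 'I_N -> F -> C) p : C :=
  \sum_i sterm (psi i) (h i) p.

(** The coordinates are the real and imaginary parts of the matrix entries; the new coefficients are
    absorbed into the h_i through their square roots. *)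
Lemma ksum_reduce (psi : 'I_nterm.+1 -> G -> C) h : (forall i, Psi (psi i)) ->
  exists (psi' : 'I_nterm -> G -> C) h', (forall i, Psi (psi' i)) /\
    ksum psi' h' = ksum psi h.
Proof.
move=> P; pose s i (j : F * F * bool) : R :=
  if j.2 then complex.Re (sterm (psi i) (h i) j.1)
  else complex.Im (sterm (psi i) (h i) j.1).
have [t [t0 [k tk] ts]] := caratheodory s.
exists (fun i => psi (lift k i)).
exists (fun i x => (Num.sqrt (t (lift k i)))%:C%C * h (lift k i) x).
split=> [i|]; first exact: P.
apply/funext => p; rewrite /ksum.
under eq_bigr do rewrite stermZ //.
transitivity (\sum_i (t i)%:C%C * sterm (psi i) (h i) p).
  by rewrite [RHS](bigD1_ord k) //= tk mul0r add0r.
have ReS (z : 'I_nterm.+1 -> C) :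
    complex.Re (\sum_i z i) = \sum_i complex.Re (z i).
  exact: (raddf_sum (@complex.Re R : Rcomplex R -> R)).
have ImS (z : 'I_nterm.+1 -> C) :
    complex.Im (\sum_i z i) = \sum_i complex.Im (z i).
  exact: (raddf_sum (@complex.Im R : Rcomplex R -> R)).
apply/eqP; rewrite eq_complex !ReS !ImS; apply/andP; split; apply/eqP.
  rewrite -[RHS](ts (p, true)); apply: eq_bigr => i _; rewrite /s /=.
  by case: (sterm _ _ _) => x y /=; rewrite mul0r subr0.
rewrite -[RHS](ts (p, false)); apply: eq_bigr => i _; rewrite /s /=.
by case: (sterm _ _ _) => x y /=; rewrite mul0r addr0.
Qed.

Lemma ksum_add (psi : 'I_nterm -> G -> C) h phi g :
  (forall i, Psi (psi i)) -> Psi phi ->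
  exists (psi' : 'I_nterm -> G -> C) h', (forall i, Psi (psi' i)) /\
    ksum psi' h' = ksum psi h + sterm phi g.
Proof.
move=> P Pphi.
have [|psi' [h' [P' e]]] := @ksum_reduce
  (fun i => oapp psi phi (unlift ord0 i)) (fun i => oapp h g (unlift ord0 i)).
  by move=> i; case: unliftP => [j|] _ /=.
exists psi', h'; split=> //; rewrite e; apply/funext => p.
rewrite -[RHS]/(ksum psi h p + sterm phi g p) /ksum big_ord_recl addrC.
by rewrite unlift_none; congr (_ + _); apply: eq_bigr => i _; rewrite liftK.
Qed.

Lemma ksum_scale N (psi : 'I_N -> G -> C) h (t : R) : 0 <= t ->
  ksum psi (fun i x => (Num.sqrt t)%:C%C * h i x) =
  fun p => t%:C%C * ksum psi h p.
Proof.
move=> t0; apply/funext => p; rewrite /ksum mulr_sumr.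
by apply: eq_bigr => i _; rewrite stermZ.
Qed.

Definition dist2 (M : F * F -> C) : R := \sum_p nm (M p) ^+ 2.

Lemma dist2E M : (dist2 M)%:C%C = ip M M.
Proof. by rewrite rmorph_sum; apply: eq_bigr => p _; rewrite /= nm_sqr. Qed.

(** On the diagonal a term contributes |h|^2 - |T_psi h|^2, whose weighted sum is at least (1 - rho)
    [wnorm d h]. The weighted trace is bounded near M0, so it bounds each term separately, whatever
    their number. *)
Lemma ksum_bounded (M0 : F * F -> C) : exists B : R,
  forall N (psi : 'I_N -> G -> C) h, (forall i, Psi (psi i)) ->
  dist2 (M0 - ksum psi h) <= dist2 M0 -> forall i a, nm (h i a) <= B.
Proof.
have [d [rho [/andP[rho0 rho1] d0 dT]]] := weights Gsg PsiT lF.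
have rho1' : 0 < 1 - rho by rewrite subr_gt0.
(* Bounds the weighted trace: a diagonal entry is at most |M0| plus the deviation x from M0, and x
   <= 1 + x^2. *)
pose K := \sum_a d a * (nm (M0 (a, a)) + 1 + dist2 M0).
exists (1 + K / (1 - rho) * \sum_a (d a)^-1) => N psi h P dM i a.
have w0 v : 0 <= wnorm d v.
  by apply: sumr_ge0 => b _; rewrite mulr_ge0 ?sqr_ge0 // ltW.
have diag u b : rank1 u (b, b) = (nm (u b) ^+ 2)%:C%C.
  by rewrite nm_sqr mulrC.
have diagK b : (\sum_i (nm (h i b) ^+ 2 - nm (mv (T (psi i)) (h i) b) ^+ 2))%:C%C
    = ksum psi h (b, b).
  rewrite rmorph_sum; apply: eq_bigr => j _; rewrite rmorphB /=.
  by rewrite -[RHS]/(rank1 _ _ - rank1 _ _) !diag.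
have le1sq (x : R) : x <= 1 + x ^+ 2 by nra.
have sumK : \sum_i (wnorm d (h i) - wnorm d (mv (T (psi i)) (h i))) <= K.
  under eq_bigr do rewrite /wnorm -sumrB.
  rewrite exchange_big; apply: ler_sum => b _ /=.
  under eq_bigr do rewrite -mulrBr.
  rewrite -mulr_sumr ler_wpM2l ?(ltW (d0 b)) //.
  apply: le_trans (_ : nm (ksum psi h (b, b)) <= _).
    by rewrite -diagK /nm normc_def /= expr0n addr0 sqrtr_sqr ler_norm.
  rewrite (_ : ksum psi h (b, b) = M0 (b, b) - (M0 - ksum psi h) (b, b)); last first.
    by rewrite -[(M0 - _) _]/(M0 (b, b) - ksum psi h (b, b)); ring.
  apply: le_trans (nmD _ _) _; rewrite -addrA lerD2l.
  rewrite [nm (- _)](_ : _ = nm ((M0 - ksum psi h) (b, b))); last by rewrite /nm normrN.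
  apply: le_trans (le1sq _) _; rewrite lerD2l; apply: le_trans dM.
  rewrite [leRHS](bigD1 (b, b)) //= lerDl; apply: sumr_ge0 => p _.
  exact: sqr_ge0.
have drop j : 0 <= wnorm d (h j) - wnorm d (mv (T (psi j)) (h j)).
  rewrite subr_ge0; apply: le_trans (dT _ _ (P j)) _.
  by rewrite ler_piMl // ltW.
have wi : wnorm d (h i) <= K / (1 - rho).
  rewrite ler_pdivlMr //; apply: le_trans sumK; rewrite (bigD1 i) //=.
  apply: ler_wpDr; first by apply: sumr_ge0 => j _; exact: drop.
  by have := dT _ (h i) (P i); lra.
apply: le_trans (le1sq _) _; rewrite lerD2l.
apply: le_trans (_ : wnorm d (h i) / d a <= _).
  rewrite ler_pdivlMr // /wnorm (bigD1 a) //= mulrC lerDl.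
  by apply: sumr_ge0 => b _; rewrite mulr_ge0 ?sqr_ge0 // ltW.
apply: ler_pM => //; first by rewrite invr_ge0 ltW.
rewrite (bigD1 a) //= lerDl; apply: sumr_ge0 => b _.
by rewrite invr_ge0 ltW.
Qed.

Lemma Re_nm_le (z : C) : `|complex.Re z| <= nm z /\ `|complex.Im z| <= nm z.
Proof.
case: z => x y; rewrite /nm normc_def /= -!sqrtr_sqr; split.
  by apply: ler_wsqrtr; rewrite lerDl sqr_ge0.
by apply: ler_wsqrtr; rewrite lerDr sqr_ge0.
Qed.

(** Competitors at least as close to M0 as the zero kernel lie in a compact product of copies of
    [Psi] and a cube, on which the distance is continuous. *)
Lemma minimizer (cPsi : compact Psi) (M0 : F * F -> C) :
  exists (psi : 'I_nterm -> G -> C) h, (forall i, Psi (psi i)) /\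
  forall psi' h', (forall i, Psi (psi' i)) ->
    dist2 (M0 - ksum psi h) <= dist2 (M0 - ksum (N := nterm) psi' h').
Proof.
have [B hB] := ksum_bounded M0.
pose J := ('I_nterm * F * bool)%type.
pose X1 := prod_topology (fun _ : 'I_nterm => {ptws G -> C}).
pose X2 := prod_topology (fun _ : J => R : topologicalType).
pose X := (X1 * X2)%type.
pose psiX (x : X) (i : 'I_nterm) : G -> C := x.1 i.
pose hX (x : X) (i : 'I_nterm) (a : F) : C :=
  Complex (x.2 (i, a, true)) (x.2 (i, a, false)).
pose A1 : set X1 := [set f | forall i, Psi (f i)].
pose A2 : set X2 := [set f | forall j, `[- B, B]%classic (f j)].
have cA : compact (A1 `*` A2).
  apply: compact_setX; first exact: (@tychonoff _ _ (fun=> Psi) (fun=> cPsi)).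
  exact: (@tychonoff _ _ (fun=> `[- B, B]%classic) (fun=> @segment_compact _ _ _)).
pose dX (x : X) : R := dist2 (M0 - ksum (psiX x) (hX x)).
have cpsi i g : continuous (fun x : X => psiX x i g : C).
  move=> x.
  apply: (@continuous_comp _ _ _ (fun x : X => x.1 i : {ptws G -> C})
    (fun phi : {ptws G -> C} => phi g)); last exact: (@proj_continuous G (fun=> C) g).
  apply: (@continuous_comp _ _ _ (fun x : X => x.1 : X1) (fun f : X1 => f i)).
    exact: cvg_fst.
  exact: (@proj_continuous 'I_nterm (fun=> {ptws G -> C}) i).
have cx j : continuous (fun x : X => x.2 j : R).
  move=> x.
  apply: (@continuous_comp _ _ _ (fun x : X => x.2 : X2) (fun f : X2 => f j)).
    exact: cvg_snd.
  exact: (@proj_continuous _ (fun=> R : topologicalType) j).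
have ch i a : continuous (fun x : X => hX x i a : C).
  exact: continuous_complex.
have cTh i a : continuous (fun x : X => mv (T (psiX x i)) (hX x i) a : C).
  apply: continuous_sum => q; apply: continuous_mulc; last exact: ch.
  by apply: continuous_sum => c; exact: cpsi.
have cst i p : continuous (fun x : X => sterm (psiX x i) (hX x i) p : C).
  have c1 : continuous (fun x : X => rank1 (hX x i) p : C).
    by apply: continuous_mulc; [exact: ch|apply: continuous_conjc; exact: ch].
  have c2 : continuous (fun x : X => rank1 (mv (T (psiX x i)) (hX x i)) p : C).
    by apply: continuous_mulc; [exact: cTh|apply: continuous_conjc; exact: cTh].
  exact: continuous_subc c1 c2.
have cks p : continuous (fun x : X => ksum (psiX x) (hX x) p : C).
  by apply: continuous_sum => i; exact: cst.
have cdX : continuous dX.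
  apply: (@continuous_sum X R R^o) => p.
  apply: (@continuous_nm_sqr R X (fun x => M0 p - ksum (psiX x) (hX x) p)).
  exact: continuous_subc (@continuous_cstc R X (M0 p)) (cks p).
have inA (psi : 'I_nterm -> G -> C) h : (forall i, Psi (psi i)) ->
    dist2 (M0 - ksum psi h) <= dist2 M0 ->
    exists2 x : X, (A1 `*` A2) x & dX x = dist2 (M0 - ksum psi h).
  move=> P dM; exists ((psi : X1), (fun j => if j.2 then complex.Re (h j.1.1 j.1.2)
    else complex.Im (h j.1.1 j.1.2)) : X2).
    split=> //= -[[i a] b]; rewrite /= in_itv /= -ler_norml.
    apply: le_trans (hB _ _ _ P dM i a).
    by case: b; case: (Re_nm_le (h i a)).
  rewrite /dX; congr (dist2 (_ - ksum _ _)).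
  by apply/funext => i; apply/funext => a; rewrite /hX /=; case: (h i a).
have [psi0 P0] := tf_nonempty PsiT.
have k0 : ksum (fun _ : 'I_nterm => psi0 : G -> C) (fun _ _ => 0) = 0.
  apply/funext => p; rewrite /ksum big1 // => i _.
  rewrite -[LHS]/(rank1 _ p - rank1 _ p) /rank1 mul0r /mv big1 ?mul0r ?subrr //.
  by move=> q _; rewrite mulr0.
have [||x0 x0A dx0] := inA (fun _ : 'I_nterm => psi0 : G -> C) (fun _ _ => 0).
- by [].
- by rewrite k0 subr0.
have A0 : (A1 `*` A2) !=set0 by exists x0.
have [x /set_mem[x1A x2A] xmin] :=
  compact_EVT_min A0 cA (continuous_subspaceT cdX).
exists (psiX x), (hX x); split=> [i|psi' h' P']; first exact: x1A.
have [dM|/ltW dM] := leP (dist2 (M0 - ksum psi' h')) (dist2 M0).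
  by have [y yA <-] := inA _ _ P' dM; apply: xmin; exact/mem_set.
apply: le_trans (xmin x0 (mem_set x0A)) _.
by rewrite dx0 k0 subr0.
Qed.

Lemma pair_sum (H : F * F -> C) : \sum_p H p = \sum_a \sum_b H (a, b).
Proof. by rewrite pair_bigA; apply: eq_bigr => -[]. Qed.

Lemma ip_rank1 (Y : F * F -> C) u : (forall a b, Y (a, b) = (Y (b, a))^*) ->
  ip Y (rank1 u) = ip u (mv (fun a b => Y (a, b)) u).
Proof.
move=> hY; rewrite {1}/ip pair_sum exchange_big.
apply: eq_bigr => b _; rewrite /mv mulr_sumr.
by apply: eq_bigr => a _; rewrite -hY /rank1 /=; ring.
Qed.

Lemma ip_herm_sym (Z W : F * F -> C) : (forall a b, Z (a, b) = (Z (b, a))^*) ->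
  (forall a b, W (a, b) = (W (b, a))^*) -> ip W Z = ip Z W.
Proof.
move=> hZ hW; rewrite /ip !pair_sum exchange_big.
apply: eq_bigr => a _; apply: eq_bigr => b _ /=.
by rewrite -hW hZ mulrC.
Qed.

(** First-order optimality: the increment is 2 t <Y, S> + t^2 <S, S>, Hermitian symmetry making <Y,
    S> real; divide by t and let t tend to 0. *)
Lemma dist2_variation (Y S : F * F -> C) :
  (forall a b, Y (a, b) = (Y (b, a))^*) -> (forall a b, S (a, b) = (S (b, a))^*) ->
  (forall t : R, 0 < t -> t < 1 ->
    dist2 Y <= dist2 (Y + (fun p => t%:C%C * S p))) ->
  0 <= ip Y S.
Proof.
move=> hY hS hd.
have : 0 <= 2 * ip Y S.
  apply: (@ge0_eps _ _ (ip S S)); first exact: ip_ge0.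
  move=> e e0; have eE : (complex.Re e)%:C%C = e by rewrite RRe_real // gtr0_real.
  have re0 : 0 < complex.Re e by rewrite -ltcR eE.
  pose t := Num.min (1 / 2) (complex.Re e).
  have t0 : 0 < t by rewrite lt_min re0 divr_gt0.
  have t1 : t < 1 by rewrite gt_min; apply/orP; left; lra.
  have te : t%:C%C <= e by rewrite -eE lecR ge_min lexx orbT.
  apply: le_trans (_ : 2 * ip Y S + t%:C%C * ip S S <= _); last first.
    by rewrite lerD2l ler_wpM2r // ip_ge0.
  have tC : 0 < t%:C%C :> C by rewrite ltcR.
  rewrite -(pmulr_rge0 _ tC); have := hd _ t0 t1; rewrite -lecR !dist2E.
  rewrite ipDl !ipDr ipZr !ipZl ipZr conjcR (ip_herm_sym hY hS) -subr_ge0.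
  by congr (0 <= _); ring.
by rewrite pmulr_rge0.
Qed.

(** The right unit of a is the only idempotent q for which some c q equals a, and then c = a. *)
Lemma mv_tz_idf (f : F -> C) : mv (tz m f) (idf R m val) = f.
Proof.
apply/funext => a; rewrite mv_tz.
have [e [g [_ gi _ ag]]] := sg_unit Gsg (val a).
have gF : g \in F by case: (lower_factors Gsg lF ag (valP a)).
rewrite (bigD1 [` gF]%fset) //= (big_pred1 a).
  rewrite big1 ?addr0 => [|q qg].
    by rewrite /idf asboolT // mulr1.
  rewrite big1 // => c /eqP/resmP cq; rewrite /idf; case: asboolP => qi.
    have ca := qi.2 _ _ cq; rewrite -ca in cq.
    have [z gq _] := pmul_assocl (sg_assoc Gsg) ag cq.
    case/negP: qg; apply/eqP/val_inj => /=.
    by rewrite -(gi.1 _ _ gq) (qi.2 _ _ gq).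
  by rewrite mulr0.
move=> c /=; apply/eqP/eqP => [/resmP /= cg|->]; last exact/resmP.
by apply: val_inj; have := gi.2 _ _ cg.
Qed.

Lemma finrep_of_kernels (cPsi : compact Psi) (f : F -> C) :
  satisfies_kernels m Psi f -> finrep f.
Proof.
move=> fk; pose M0 : F * F -> C := rank1 (idf R m val) - rank1 f.
have [psi [h [P hmin]]] := minimizer cPsi M0.
pose K := ksum psi h; pose Y : F * F -> C := K - M0.
have hr u a b : rank1 u (a, b) = (rank1 u (b, a))^*.
  by rewrite /rank1 rmorphM /= conjCK mulrC.
have hs psi' h' a b : sterm psi' h' (a, b) = (sterm psi' h' (b, a))^*.
  by rewrite -[LHS]/(rank1 _ _ - rank1 _ _) hr (hr (mv _ _)) -rmorphB.
have hK a b : K (a, b) = (K (b, a))^*.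
  by rewrite /K /ksum rmorph_sum; apply: eq_bigr => i _; rewrite hs.
have hY a b : Y (a, b) = (Y (b, a))^*.
  rewrite -[LHS]/(K _ - (rank1 _ _ - rank1 _ _)) hK hr (hr f) -!rmorphB.
  by [].
have variation S := dist2_variation (S := S) hY.
have dist2N Z : dist2 (- Z) = dist2 Z.
  by apply: eq_bigr => p _; rewrite -[(- Z) p]/(- Z p) /nm normrN.
have YE : Y = - (M0 - K) by rewrite opprB.
(* Optimality against adding t times a generator of the cone. *)
have Ysterm psi' h' : Psi psi' -> 0 <= ip Y (sterm psi' h').
  move=> P'; apply: variation => [a b|t t0 _]; first exact: hs.
  have [psi2 [h2 [P2 e2]]] :=
    ksum_add h (fun x => (Num.sqrt t)%:C%C * h' x) P P'.
  have -> : Y + (fun p => t%:C%C * sterm psi' h' p) = - (M0 - ksum psi2 h2).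
    rewrite e2 opprB /Y addrAC -/K; congr (_ + _ - _).
    by apply/funext => p; rewrite stermZ // ltW.
  by rewrite dist2N YE dist2N; exact: hmin.
(* Optimality against shrinking K to (1 - t) K. *)
have YK : ip Y K <= 0.
  rewrite -oppr_ge0 -ipNr; apply: variation => [a b|t t0 t1].
    by rewrite -[LHS]/(- K _) hK -rmorphN.
  have -> : Y + (fun p => t%:C%C * (- K) p) =
      - (M0 - ksum psi (fun i x => (Num.sqrt (1 - t))%:C%C * h i x)).
    rewrite ksum_scale ?subr_ge0 ?(ltW t1) // -/K; apply/funext => p.
    rewrite -[LHS]/(K p - M0 p + t%:C%C * - K p).
    rewrite -[RHS]/(- (M0 p - (1 - t)%:C%C * K p)) rmorphB rmorph1; ring.
  by rewrite dist2N YE dist2N; exact: hmin.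
pose L a b := Y (a, b).
have hL : herm L by move=> a b; exact: hY.
have LT psi' : Psi psi' -> codominates m L (fres psi').
  move=> P' u; rewrite -subr_ge0 -!ip_rank1 // -ipNr -ipDr.
  exact: Ysterm.
have pL := pos_of_codominates Gsg PsiT lF hL LT.
have YM : 0 <= ip Y M0.
  rewrite /M0 ipDr ipNr !ip_rank1 // subr_ge0 -{1 2}(mv_tz_idf f).
  exact: (codominates_of_kernels Gsg PsiT lF fk pL LT).
(* <Y, Y> = <Y, K> - <Y, M0>, at most 0 by the two signs just found. *)
have Y0 : Y = 0.
  apply: ip_eq0; apply: le_anti; rewrite ip_ge0 andbT.
  rewrite {2}/Y ipDr ipNr; apply: le_trans YK; by rewrite lerBlDr lerDl.
exists nterm, psi, h; split=> // p.
have := congr1 (fun g => g p) Y0; rewrite -[LHS]/(K p - M0 p) => /eqP.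
by rewrite subr_eq0 => /eqP e; exact: esym e.
Qed.

End FiniteRepresentation.

(** * Dual kernels *)

Section Cholesky.
Variables (R : realType) (X : topologicalType) (I : finType).
Local Notation C := R[i].
Local Notation B := (Cb R X).

Lemma Cb_ext (a b : B) : (forall w, a w = b w) -> a = b.
Proof. by move=> ab; apply/val_inj/funext. Qed.

Lemma CbM (a b : B) w : (a * b) w = a w * b w. Proof. by []. Qed.
Lemma CbB (a b : B) w : (a - b) w = a w - b w. Proof. by []. Qed.
Lemma CbD (a b : B) w : (a + b) w = a w + b w. Proof. by []. Qed.
Lemma CbZ (c : C) (a : B) w : (c *: a) w = c * a w. Proof. by []. Qed.
Lemma Cb0 w : (0 : B) w = 0. Proof. by []. Qed.
Lemma Cb1 w : (1 : B) w = 1. Proof. by []. Qed.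

Lemma Cb_sum (J : Type) (r : seq J) (P : pred J) (a : J -> B) w :
  (\sum_(j <- r | P j) a j) w = \sum_(j <- r | P j) a j w.
Proof. by elim/big_rec2: _ => // j b c _ <-. Qed.

(** Completing the square: v changes u at s alone, so as to make (M v)_s vanish. *)
Lemma schur_complement (M : I -> I -> C) s (u : I -> C) : posm M -> M s s != 0 ->
  exists2 v, (forall i, i != s -> v i = u i) &
    ip u (mv (fun i j => M i j - M i s * M s j / M s s) u) = ip v (mv M v).
Proof.
move=> pM ss; have hM := posm_herm pM.
pose c := mv M u s / M s s; pose dl : I -> C := fun i => (i == s)%:R.
exists (u - (fun i => c * dl i)).
  move=> i /negbTE is_; rewrite -[LHS]/(u i - c * dl i) /dl is_ mulr0 subr0 //.
have dM w : ip dl (mv M w) = mv M w s by exact: ip_delta.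
have Md : ip u (mv M dl) = (mv M u s)^*.
  by rewrite (ip_herm _ _ hM) -ipC dM.
have Mds : mv M dl s = M s s by rewrite mv_delta.
rewrite mvD mvN mvZ ipDl !ipDr !ipNl !ipNr ipZl !ipZr !ipZl !dM Md Mds.
have -> : mv (fun i j => M i j - M i s * M s j / M s s) u
    = mv M u - (fun i => c * mv M dl i).
  apply/funext => i; rewrite -[RHS]/(mv M u i - c * mv M dl i) mv_delta /c.
  rewrite /mv mulrAC !mulr_suml -sumrB; apply: eq_bigr => j _.
  by field.
rewrite ipDr ipNr ipZr Md /c; field; rewrite ss andbT.
by rewrite conjC_eq0.
Qed.

Variable Gam : I -> I -> {linear B -> C}.
Hypothesis pGam : forall g : I -> B,
  0 <= \sum_x \sum_y Gam x y (g x * Cb_conj (g y)).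

Lemma inv_sqrt_subproof (a : B) (e : R) : 0 < e -> (forall w, e%:C%C <= a w) ->
  (fun w => Complex (Num.sqrt (nm (a w)))^-1 0) \in @Cb_pred R X.
Proof.
move=> e0 ae; have [ca _] := (Cb_predP _).1 (Cb_valP a).
have an w : e <= nm (a w).
  rewrite -lecR nmE ger0_norm //; apply: le_trans (ae w).
  by rewrite lecR ltW.
apply/Cb_predP; split.
  apply: continuous_complex; last by move=> w; exact: cvg_cst.
  move=> w; apply: cvgV.
    by rewrite gt_eqF // sqrtr_gt0; exact: lt_le_trans e0 (an w).
  apply: (@continuous_comp _ _ _ (fun w => nm (a w)) (fun z : R => Num.sqrt z)).
    apply: (@continuous_comp _ _ _ (a : X -> C) (fun z : C => nm z)); first exact: ca.
    exact: Re_norm_continuous.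
  exact: sqrt_continuous.
exists ((Num.sqrt e)^-1)%:C%C => w.
rewrite normc_def /= expr0n addr0 sqrtr_sqr lecR ger0_norm ?invr_ge0 ?sqrtr_ge0 //.
rewrite lef_pV2 ?posrE ?sqrtr_gt0 //; last exact: lt_le_trans e0 (an w).
by rewrite ler_wsqrtr.
Qed.

(** Induction on the support: the pivot H s s is at least e, so the column at s divided by its
    square root is still in C_b. Subtracting that rank-one part, on which Gamma is nonnegative,
    leaves a Schur complement on S minus s with the same lower bound e. *)
Lemma cholesky_ge0 (n : nat) (S : {set I}) (H : I -> I -> B) (e : R) :
  0 < e -> (#|S| <= n)%N ->
  (forall i j, i \notin S -> H i j = 0) ->
  (forall w u, e%:C%C * (\sum_(i in S) (u i)^* * u i)
     <= ip u (mv (fun i j => H i j w) u)) ->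
  0 <= \sum_x \sum_y Gam x y (H y x).
Proof.
move=> e0; elim: n S H => [|n IH] S H Sn HS Hpos.
  rewrite big1 // => x _; rewrite big1 // => y _; rewrite HS ?linear0 //.
  by move: Sn; rewrite leqn0 cards_eq0 => /eqP ->; rewrite inE.
have [S0|[s sS]] := set_0Vmem S.
  by apply: (IH S H) => //; rewrite S0 cards0.
have pH w : posm (fun i j => H i j w).
  move=> u; apply: le_trans (Hpos w u); apply: mulr_ge0; first by rewrite ler0c ltW.
  by apply: sumr_ge0 => i _; rewrite mulrC mul_conjC_ge0.
have hH i j w : H i j w = (H j i w)^* := posm_herm (pH w) i j.
have Hss w : e%:C%C <= H s s w.
  have := Hpos w (fun i => (i == s)%:R); rewrite ip_delta mv_delta.
  rewrite (bigD1 s) //= eqxx conjC1 mulr1 big1 ?addr0 ?mulr1 //.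
  by move=> i /andP[_ /negbTE ->]; rewrite mulr0.
pose r : B := MkCb (inv_sqrt_subproof e0 Hss).
have Hss_real w : (nm (H s s w))%:C%C = H s s w.
  rewrite nmE ger0_norm //; apply: le_trans (Hss w).
  by rewrite ler0c ltW.
have Hss0 w : H s s w != 0.
  by rewrite gt_eqF //; apply: lt_le_trans (Hss w); rewrite ltcR.
have rr w : r w * (r w)^* = (H s s w)^-1.
  rewrite (_ : (r w)^* = r w); last exact: conjcR.
  rewrite -[r w]/((Num.sqrt (nm (H s s w)))^-1)%:C%C -rmorphM -invfM -expr2.
  by rewrite sqr_sqrtr ?nm_ge0 // fmorphV /= Hss_real.
pose g x : B := r * H s x.
pose H' y x := H y x - g x * Cb_conj (g y).
have H'E y x w : H' y x w = H y x w - H y s w * H s x w / H s s w.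
  have gg : (g x * Cb_conj (g y)) w = (r w * H s x w) * (r w * H s y w)^* by [].
  rewrite /H' CbB gg; move: (r w) (rr w) => z <-.
  by rewrite rmorphM /= -hH; ring.
have -> : \sum_x \sum_y Gam x y (H y x) =
    \sum_x \sum_y Gam x y (g x * Cb_conj (g y)) + \sum_x \sum_y Gam x y (H' y x).
  rewrite -big_split; apply: eq_bigr => x _; rewrite -big_split.
  by apply: eq_bigr => y _ /=; rewrite -linearD /H' addrC subrK.
apply: addr_ge0; first exact: pGam.
apply: (IH (S :\ s) H').
- by rewrite -ltnS; move: Sn; rewrite (cardsD1 s S) sS.
- move=> i j; rewrite !inE negb_and negbK => /orP[/eqP ->|iS]; apply: Cb_ext => w.
    by rewrite H'E mulrAC divff // mul1r subrr.
  by rewrite H'E !(HS i) // Cb0 !mul0r subr0.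
move=> w u; have [v vu eqv] := schur_complement u (pH w) (Hss0 w).
rewrite (_ : (fun i j => H' i j w) =
    fun i j => H i j w - H i s w * H s j w / H s s w); last first.
  by apply/funext => i; apply/funext => j; rewrite H'E.
rewrite eqv; apply: le_trans (Hpos w v); rewrite ler_wpM2l ?ler0c ?(ltW e0) //.
rewrite [leRHS](big_setD1 s) //= -[leLHS]add0r; apply: lerD.
  by rewrite mulrC mul_conjC_ge0.
by apply: ler_sum => i; rewrite !inE => /andP[/vu ->].
Qed.

(** Pivots may vanish, so e is added to the diagonal; the cost is e times the sum of the nonnegative
    numbers Gamma(x, x)(1). *)
Lemma pairing_ge0 (H : I -> I -> B) :
  (forall w, posm (fun i j => H i j w)) ->
  0 <= \sum_x \sum_y Gam x y (H y x).
Proof.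
move=> pH; apply: (@ge0_eps _ _ (\sum_x Gam x x 1)).
  apply: sumr_ge0 => x _.
  have := pGam (fun y => if y == x then 1 else 0).
  rewrite (bigD1 x) //= eqxx (bigD1 x) //= eqxx big1 ?addr0; last first.
    move=> y /negbTE ->; rewrite (_ : _ * _ = 0) ?linear0 //.
    by apply: Cb_ext => w; rewrite CbM mul1r -[LHS]/(0^*) conjC0.
  rewrite big1 ?addr0; last first.
    move=> z /negbTE ->; rewrite big1 // => y _; rewrite mul0r linear0 //.
  by congr (0 <= Gam x x _); apply: Cb_ext => w; rewrite CbM mul1r -[LHS]/(1^*) conjC1.
move=> e e0; have eE : (complex.Re e)%:C%C = e by rewrite RRe_real // gtr0_real.
have re0 : 0 < complex.Re e by rewrite -ltcR eE.
pose H' i j := H i j + (e * (i == j)%:R) *: (1 : B).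
have := @cholesky_ge0 #|I| [set: I]%SET H' (complex.Re e) re0.
rewrite cardsT => /(_ (leqnn _)).
have -> : \sum_x \sum_y Gam x y (H' y x) =
    \sum_x \sum_y Gam x y (H y x) + e * \sum_x Gam x x 1.
  rewrite mulr_sumr -big_split; apply: eq_bigr => x _ /=.
  under eq_bigr do rewrite linearD linearZ /=.
  rewrite big_split /=; congr (_ + _); rewrite (bigD1 x) //= eqxx mulr1 big1 ?addr0 //.
  by move=> y /negbTE ->; rewrite mulr0 scale0r.
apply; first by move=> i j; rewrite inE.
move=> w u; rewrite eE.
have -> : (fun i j => H' i j w) = fun i j => H i j w + e * (i == j)%:R.
  by apply/funext => i; apply/funext => j; rewrite /H' CbD CbZ Cb1 mulr1.
have -> : \sum_(i in [set: I]%SET) (u i)^* * u i = ip u u.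
  by apply: eq_bigl => i; rewrite inE.
by rewrite mv_eps ipDr ipZr lerDr; exact: pH.
Qed.

End Cholesky.

(** * From dual kernels to condition (ii) *)

Section DualCertificate.
Variables (R : realType) (G : choiceType) (m : pmul G) (Gsg : semigroupoid m).
Local Notation C := R[i].
Variables (Psi : set {ptws G -> C}) (PsiT : test_functions m Psi).
Variable cPsi : compact Psi.
Variables (F : {fset G}) (lF : lower m [set` F]).
Local Notation mF := (resm m F).
Local Notation B := (Cb R Psi).

Definition rmul (g : F -> C) (a p : F) : C := \sum_(q | mF p q == Some a) g q.

Lemma mv_rmul g v : mv (rmul g) v = mv (tz m v) g.
Proof.
apply/funext => a; rewrite mv_tz.
transitivity (\sum_p \sum_(q | mF p q == Some a) v p * g q).
  by apply: eq_bigr => p _; rewrite mulr_suml; apply: eq_bigr => q _; rewrite mulrC.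
rewrite (exchange_big_dep xpredT) //=.
Qed.

(** Associativity of convolution: with indicators in place of side conditions, both sides become one
    sum over triples, weighted by [mul3l] and by [mul3r]. *)
Lemma tz_assoc (f g h : F -> C) :
  mv (tz m (mv (tz m f) g)) h = mv (tz m f) (mv (tz m g) h).
Proof.
apply/funext => a.
have indE (x : F) (k : F -> C) (P : F -> option F) :
    \sum_(q | P q == Some x) k q = \sum_q (P q == Some x)%:R * k q.
  rewrite big_mkcond; apply: eq_bigr => q _.
  by case: ifP => _; rewrite ?mul1r ?mul0r.
have bindE (o : option F) (P : F -> option F) :
    \sum_c (P c == Some a)%:R * (o == Some c)%:R = (obind P o == Some a)%:R :> C.
  case: o => [c|] /=; last by rewrite big1 // => c _; rewrite mulr0.
  rewrite (bigD1 c) //= eqxx mulr1 big1 ?addr0 // => d dc.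
  by rewrite (inj_eq Some_inj) [c == d]eq_sym (negbTE dc) mulr0.
transitivity (\sum_q \sum_r \sum_d
    (mul3l mF d r q == Some a)%:R * (f d * g r * h q)).
  rewrite mv_tz; apply: eq_bigr => q _; rewrite indE.
  under eq_bigr => c _ do rewrite mv_tz mulr_suml mulr_sumr.
  rewrite exchange_big; apply: eq_bigr => r _.
  under eq_bigr => c _ do rewrite indE mulr_suml mulr_sumr.
  rewrite exchange_big; apply: eq_bigr => d _.
  rewrite /mul3l -bindE mulr_suml; apply: eq_bigr => c _ /=; ring.
rewrite mv_tz.
under [RHS]eq_bigr => s _ do rewrite indE.
under [RHS]eq_bigr => s _ do under eq_bigr => d _ do
  rewrite mv_tz mulr_sumr mulr_sumr.
under [RHS]eq_bigr => s _ do rewrite exchange_big.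
rewrite [RHS]exchange_big; apply: eq_bigr => q _.
under [RHS]eq_bigr => s _ do under eq_bigr => d _ do
  rewrite indE mulr_sumr mulr_sumr.
under [RHS]eq_bigr => s _ do rewrite exchange_big.
rewrite [RHS]exchange_big; apply: eq_bigr => r _.
rewrite [RHS]exchange_big; apply: eq_bigr => d _.
rewrite (resm_assoc Gsg lF) /mul3r -bindE mulr_suml.
by apply: eq_bigr => s _ /=; ring.
Qed.

Lemma tz_rmul (psi g v : F -> C) :
  mv (rmul g) (mv (tz m psi) v) = mv (tz m psi) (mv (rmul g) v).
Proof. by rewrite !mv_rmul tz_assoc. Qed.

Variables (f : F -> C) (Gam : F -> F -> banach_dual B).
Hypothesis pGam : pos_dual_kernel Gam.
Hypothesis fGam : forall x y : F,
  kone R m (val x) (val y) - outer f x y = hatstar m (Cb_eval cPsi) Gam x y.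

Lemma pos_dual_kernel_fin (g : F -> B) :
  0 <= \sum_x \sum_y Gam x y (g x * Cb_conj (g y)).
Proof.
pose A := fset_set [set: F].
have inT (x : F) : x \in A by rewrite in_fset_set ?in_setT //; exact: finite_finset.
have sumA (k : F -> C) : \sum_x k x = \sum_(x : A) k (val x).
  rewrite (reindex (val : A -> F)) //.
  by exists (fun x => [` inT x]%fset) => x _; rewrite //; exact: val_inj.
have := pGam (fun x : A => g (val x)); congr (0 <= _).
by rewrite sumA; apply: eq_bigr => x _; rewrite sumA.
Qed.

(** At psi these are the coefficients of the map sending a kernel A to A - T_psi A T_psi^*. *)
Definition defect_coef (s q x y : F) : B :=
  \sum_(p | mF p q == Some x) \sum_(r | mF r s == Some y)
    (kone R m (val p) (val r) *: (1 : B)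
     - Cb_eval cPsi (val p) * Cb_conj (Cb_eval cPsi (val r))).

Lemma hatstarE x y : hatstar m (Cb_eval cPsi) Gam x y =
  \sum_q \sum_s Gam q s (defect_coef s q x y).
Proof.
rewrite /hatstar sum_factor; apply: eq_bigr => q _.
under eq_bigr => p _ do rewrite sum_factor /=.
rewrite exchange_big; apply: eq_bigr => s _; rewrite /defect_coef linear_sum.
by apply: eq_bigr => p _; rewrite linear_sum.
Qed.

Lemma defect_coefE s q x y (w : Psi) : defect_coef s q x y w =
  (x == q)%:R * (y == s)%:R
  - tz m (fres (val w)) x q * (tz m (fres (val w)) y s)^*.
Proof.
rewrite -[(y == s)%:R in RHS]conjC_nat -!(tz_delta R Gsg lF).
rewrite /defect_coef /tz /toeplitz Cb_sum !rmorph_sum !mulr_suml -sumrB.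
apply: eq_bigr => p _; rewrite Cb_sum !mulr_sumr -sumrB; apply: eq_bigr => r _.
by rewrite koneE CbB CbZ CbM Cb1 mulr1.
Qed.

Lemma codominates_at_unit (L : F -> F -> C) : posm L ->
  (forall psi, Psi psi -> codominates m L (fres psi)) ->
  ip f (mv L f) <= ip (idf R m val) (mv L (idf R m val)).
Proof.
move=> pL LT; rewrite -subr_ge0; have hL := posm_herm pL.
pose H (s q : F) : B := \sum_x \sum_y L y x *: defect_coef s q x y.
have Hw w : (fun s q => H s q w) = fun s q => 1 * L s q -
    mm (adj (tz m (fres (val w)))) (mm L (tz m (fres (val w)))) s q.
  apply/funext => s; apply/funext => q; rewrite /H Cb_sum.
  under eq_bigr do rewrite Cb_sum.
  under eq_bigr => x _ do under eq_bigr => y _ do rewrite CbZ defect_coefE mulrBr.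
  under eq_bigr => x _ do rewrite sumrB.
  rewrite sumrB; congr (_ - _).
    rewrite (bigD1 q) //= [X in _ + X]big1 ?addr0; last first.
      by move=> x /negbTE xq; rewrite big1 // => y _; rewrite xq mul0r mulr0.
    rewrite (bigD1 s) //= [X in _ + X]big1 ?addr0; last first.
      by move=> y /negbTE ->; rewrite !mulr0.
    by rewrite !eqxx !mulr1 mul1r.
  rewrite exchange_big; apply: eq_bigr => y _; rewrite /mm mulr_sumr.
  by apply: eq_bigr => x _; rewrite /adj; ring.
have pH w : posm (fun s q => H s q w).
  move=> u; rewrite Hw -[X in mm _ (mm _ X)]adjK defect_form adjK.
  by rewrite mul1r subr_ge0; apply: LT; exact: set_valP.
have := pairing_ge0 pos_dual_kernel_fin pH.
have ipE u : ip u (mv L u) = \sum_x \sum_y L y x * (u x * (u y)^*).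
  rewrite exchange_big; apply: eq_bigr => y _; rewrite mulr_sumr.
  by apply: eq_bigr => x _; ring.
rewrite !ipE -sumrB.
under [X in _ -> 0 <= X]eq_bigr => x _ do rewrite -sumrB.
congr (0 <= _).
transitivity (\sum_q \sum_s \sum_x \sum_y L y x * Gam q s (defect_coef s q x y)).
  apply: eq_bigr => q _; apply: eq_bigr => s _; rewrite linear_sum.
  apply: eq_bigr => x _; rewrite linear_sum; apply: eq_bigr => y _.
  by rewrite linearZ.
under [LHS]eq_bigr => q _ do rewrite exchange_big.
rewrite [LHS]exchange_big; apply: eq_bigr => x _ /=.
under [LHS]eq_bigr => q _ do rewrite exchange_big.
rewrite [LHS]exchange_big; apply: eq_bigr => y _ /=.
transitivity (L y x * \sum_q \sum_s Gam q s (defect_coef s q x y)).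
  by rewrite mulr_sumr; apply: eq_bigr => q _; rewrite mulr_sumr.
rewrite -hatstarE -fGam koneE mulrBr; congr (_ * (_ * _) - _).
Qed.

(** For Q the right convolution by g, Q^* L Q inherits the hypotheses because Q commutes with
    Toeplitz operators; Q takes the unit to g and f to T_f g. *)
Lemma codominates_of_dual (L : F -> F -> C) : posm L ->
  (forall psi, Psi psi -> codominates m L (fres psi)) -> codominates m L f.
Proof.
move=> pL LT g; pose L' := mm (adj (rmul g)) (mm L (rmul g)).
have L'E u : ip u (mv L' u) = ip (mv (rmul g) u) (mv L (mv (rmul g) u)).
  by rewrite /L' !mv_mm ip_adj adjK.
have pL' : posm L' by exact: posm_congr.
have L'T psi : Psi psi -> codominates m L' (fres psi).
  by move=> P u; rewrite !L'E tz_rmul; exact: LT.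
have := codominates_at_unit pL' L'T; rewrite !L'E !mv_rmul.
suff -> : mv (tz m (idf R m val)) g = g by [].
by rewrite -[RHS]mv_id; congr mv; apply/funext => a; apply/funext => b; exact: tz_delta.
Qed.

Lemma satisfies_kernels_of_dual : satisfies_kernels m Psi f.
Proof.
apply/(satisfies_kernelsP Gsg _ _ lF) => k kK u; rewrite -subr_ge0.
have [pk kT] := K_PsiP Gsg lF kK; set K := kres k in pk kT *.
apply: (@ge0_eps _ _ (ip u u)); first exact: ip_ge0.
move=> e e0; have [L [KL LK]] := regularized_inv pk e0.
pose Ke (a b : F) := K a b + e * (a == b)%:R.
have KeE v : ip v (mv Ke v) = ip v (mv K v) + e * ip v v.
  by rewrite mv_eps ipDr ipZr.
have pKe : posm Ke.
  by move=> v; rewrite KeE addr_ge0 ?pk // mulr_ge0 ?ip_ge0 // ltW.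
have KeL v : mv Ke (mv L v) = v.
  rewrite -mv_mm -[RHS]mv_id; congr mv; apply/funext => a; apply/funext => b.
  exact: KL.
have LKe v : mv L (mv Ke v) = v.
  rewrite -mv_mm -[RHS]mv_id; congr mv; apply/funext => a; apply/funext => b.
  exact: LK.
have pL : posm L.
  by move=> v; rewrite -{1}(KeL v) -(ip_herm _ _ (posm_herm pKe)); exact: pKe.
have LT psi : Psi psi -> codominates m L (fres psi).
  move=> P; apply: (contractive_inv pKe KeL) => v; rewrite !KeE.
  by apply: lerD; [exact: kT|rewrite ler_pM2l //; exact: (tz_adj_contractive PsiT)].
have := contractive_inv (T := adj (tz m f)) pL LKe.
rewrite adjK => /(_ (codominates_of_dual pL LT) u); rewrite !KeE -subr_ge0 => h.
apply: le_trans h _; rewrite opprD addrACA lerD2l lerBlDr lerDl.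
by rewrite mulr_ge0 ?ip_ge0 // ltW.
Qed.

End DualCertificate.

(** * Combinations of point evaluations as elements of the dual *)

Section EvaluationFunctionals.
Variables (R : realType) (X : topologicalType) (N : nat).
Local Notation C := R[i].
Local Notation B := (Cb R X).
Variables (c : 'I_N -> C) (w : 'I_N -> X).

Definition eval_comb (b : B) : C := \sum_i c i * b (w i).

Lemma eval_comb_linear : linear eval_comb.
Proof.
move=> k a b; rewrite /eval_comb scaler_sumr -big_split; apply: eq_bigr => i _ /=.
by rewrite -[X in c i * X = _]/(k * a (w i) + b (w i)) mulrDr mulrCA.
Qed.

HB.instance Definition _ :=
  GRing.isLinear.Build C B C *:%R eval_comb eval_comb_linear.

Lemma eval_comb_continuous : continuous eval_comb.
Proof.
pose M := \sum_i `|c i|.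
have bnd b : `|eval_comb b| <= M * `|b|.
  apply: le_trans (ler_norm_sum _ _ _) _; rewrite mulr_suml.
  by apply: ler_sum => i _; rewrite normrM ler_wpM2l //; exact: le_sup_norm.
have M0 : 0 <= M by exact: sumr_ge0.
apply: bounded_linear_continuous; apply/linear_boundedP; near=> r => b.
apply: le_trans (bnd b) _; rewrite ler_wpM2r //; near: r.
by apply: nbhs_pinfty_ge; exact: ger0_real.
Unshelve. all: by end_near. Qed.

Definition eval_functional : banach_dual B := BanachDual eval_comb_continuous.

End EvaluationFunctionals.

Section RepresentationToDual.
Variables (R : realType) (G : choiceType) (m : pmul G) (Gsg : semigroupoid m).
Local Notation C := R[i].
Variables (Psi : set {ptws G -> C}) (cPsi : compact Psi).
Variables (F : {fset G}) (lF : lower m [set` F]).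

Lemma dual_of_finrep (f : F -> C) : finrep m Psi f ->
  exists Gam : F -> F -> banach_dual (Cb R Psi), pos_dual_kernel Gam /\
    forall x y : F, kone R m (val x) (val y) - outer f x y
                    = hatstar m (Cb_eval cPsi) Gam x y.
Proof.
move=> [N [psi [h [P fh]]]].
pose w i : Psi := exist _ (psi i : {ptws G -> C}) (mem_set (P i)).
exists (fun x y => eval_functional (fun i => h i x * (h i y)^*) w); split.
  move=> A g; rewrite /= /eval_comb.
  under eq_bigr do rewrite exchange_big; rewrite exchange_big.
  apply: sumr_ge0 => i _.
  pose z := \sum_(x : A) h i (val x) * g x (w i).
  rewrite (_ : \sum_x _ = z * z^*) ?mul_conjC_ge0 // /z mulr_suml.
  apply: eq_bigr => x _; rewrite rmorph_sum mulr_sumr; apply: eq_bigr => y _.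
  by rewrite CbM -[Cb_conj (g y) (w i)]/((g y (w i))^*) rmorphM /=; ring.
move=> x y; rewrite (hatstarE _ _ _ x y) /= /eval_comb.
under eq_bigr do rewrite exchange_big; rewrite exchange_big.
have := fh (x, y); rewrite -[LHS]/(_ * _ - _ * _) /= -koneE => ->.
apply: eq_bigr => i _; rewrite -[LHS]/(rank1 _ _ - rank1 _ _) /rank1 /=.
under eq_bigr => q _ do under eq_bigr => s _ do
  rewrite (defect_coefE Gsg cPsi lF) /= mulrBr.
under eq_bigr => q _ do rewrite sumrB.
rewrite sumrB; congr (_ - _).
  rewrite (bigD1 x) //= [X in _ + X]big1 ?addr0; last first.
    move=> q; rewrite eq_sym => /negbTE xq.
    by rewrite big1 // => s _; rewrite xq mul0r mulr0.
  rewrite (bigD1 y) //= [X in _ + X]big1 ?addr0; last first.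
    by move=> q; rewrite eq_sym => /negbTE ->; rewrite !mulr0.
  by rewrite !eqxx !mulr1.
rewrite /mv mulr_suml; apply: eq_bigr => q _; rewrite rmorph_sum mulr_sumr.
by apply: eq_bigr => s _; rewrite rmorphM /=; ring.
Qed.

End RepresentationToDual.

(** * Transfer functions *)

Section TransferFunction.
Variables (R : realType) (G : choiceType) (m : pmul G) (Gsg : semigroupoid m).
Local Notation C := R[i].
Variables (Psi : set {ptws G -> C}) (PsiT : test_functions m Psi).

Lemma finite_factor a : finite_set (Defs.factor m a).
Proof.
have [F lF aF] := lower_hull Gsg [fset a]%fset.
have aF' : a \in F by apply: aF; rewrite inE.
apply: (@sub_finite_set _ _ ([set` F] `*` [set` F])); last first.
  by apply: finite_setX; exact: finite_fset.
by move=> [p q] /= /(lower_factors Gsg lF) /(_ aF').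
Qed.

(** Omits the factorization of x by its left unit, the only one that involves v x; the remaining
    ones use v at smaller rank. *)
Definition star_lt (psi v : G -> C) (x : G) : C :=
  \sum_(p \in Defs.factor m x `\ (lunit Gsg x, x)) psi p.1 * v p.2.

Lemma star_split psi v x :
  star m psi v x = psi (lunit Gsg x) * v x + star_lt psi v x.
Proof.
rewrite /star (fsbigD1 (lunit Gsg x, x)) //; first exact: finite_factor.
exact: lunitP.
Qed.

Lemma eq_star_lt psi v v' x :
  (forall q, (rank m q < rank m x)%N -> v q = v' q) ->
  star_lt psi v x = star_lt psi v' x.
Proof.
move=> vv; apply: eq_fsbigr => -[p q] /set_mem[/= pq npq].
rewrite vv //; apply: (rank_lt Gsg pq); apply/eqP => /= qx; apply: npq.
by rewrite -(lunit_uniq Gsg (_ : m p x = Some x)) ?qx // -{1}qx.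
Qed.

Variables (N : nat) (psi : 'I_N -> G -> C) (P : forall i, Psi (psi i)).
Variables (U : 'M[C]_(1 + N)) (UU : U *m adjmx U = 1%:M).

(** Rows are multiplied by U on the right, (delta, psi * V) U = (phi, V); these two blocks give the
    equation for V. *)
Let u0 : 'rV[C]_N := ursubmx U.
Let U' : 'M[C]_N := drsubmx U.

Definition diag_eval x : 'M[C]_N := diag_mx (\row_i psi i (lunit Gsg x)).
Definition resolvent x : 'M[C]_N := 1%:M - diag_eval x *m U'.

Definition sqn n (v : 'rV[C]_n) : C := (v *m adjmx v) 0 0.

Lemma sqnE n (v : 'rV[C]_n) : sqn v = \sum_i `|v 0 i| ^+ 2.
Proof. by rewrite /sqn mxE; apply: eq_bigr => i _; rewrite !mxE normCK. Qed.

Lemma sqn_mulU (v : 'rV[C]_(1 + N)) : sqn (v *m U) = sqn v.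
Proof. by rewrite /sqn adjmxM mulmxA -(mulmxA v) UU mulmx1. Qed.

Lemma sqn_row_mx (a : 'rV[C]_1) (b : 'rV[C]_N) :
  sqn (row_mx a b) = sqn a + sqn b.
Proof.
rewrite !sqnE big_split_ord /=; congr (_ + _); apply: eq_bigr => i _.
  by rewrite row_mxEl.
by rewrite row_mxEr.
Qed.

Lemma sqn_mulU' v : sqn (v *m U') <= sqn v.
Proof.
have := sqn_mulU (row_mx 0 v); rewrite -[U]submxK mul_row_block !mul0mx !add0r.
rewrite !sqn_row_mx (_ : sqn 0 = 0) ?add0r => [<-|].
  by rewrite lerDr sqnE sumr_ge0 // => i _; rewrite exprn_ge0.
by rewrite /sqn mul0mx mxE.
Qed.

(** U' is a contraction and the diagonal consists of values at an idempotent, of modulus at most r <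
    1; so v = v D U' forces |v|^2 <= r^2 |v|^2. *)
Lemma resolvent_unit x : resolvent x \in unitmx.
Proof.
rewrite unitmxE unitfE; apply/negP => /det0P[v v0].
rewrite /resolvent mulmxBr mulmx1 => /eqP; rewrite subr_eq0 => /eqP vE.
have [F lF eF] := lower_hull Gsg [fset lunit Gsg x]%fset.
have eF' : lunit Gsg x \in F by apply: eF; rewrite inE.
have [r /andP[r0 r1] hr] := test_idem_lt1 PsiT F.
have re i : `|psi i (lunit Gsg x)| ^+ 2 <= (r ^+ 2)%:C%C.
  rewrite -nmE -rmorphXn lecR ler_sqr ?nnegrE ?nm_ge0 //.
  exact: (hr _ [` eF']%fset (P i) (lunit_idem Gsg x)).
have h : sqn v <= (r ^+ 2)%:C%C * sqn v.
  rewrite {1}vE mulmxA; apply: le_trans (sqn_mulU' _) _.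
  rewrite !sqnE mulr_sumr; apply: ler_sum => i _.
  rewrite /diag_eval mul_mx_diag !mxE normrM exprMn mulrC.
  by rewrite ler_wpM2r // exprn_ge0.
have r21 : (r ^+ 2)%:C%C < 1 :> C by rewrite -[1]/(1%:C%C) ltcR expr_lt1.
have sv : sqn v = 0.
  have r2 : 0 < 1 - (r ^+ 2)%:C%C by rewrite subr_gt0.
  apply: le_anti; apply/andP; split.
    by rewrite -(pmulr_rle0 _ r2) mulrBl mul1r subr_le0.
  by rewrite sqnE sumr_ge0 // => i _; rewrite exprn_ge0.
case/negP: v0; apply/eqP/rowP => i; rewrite mxE; apply/eqP.
move/eqP: sv; rewrite sqnE psumr_eq0 => [|j _]; last by rewrite exprn_ge0.
by move/allP/(_ i (mem_index_enum i)); rewrite /= expf_eq0 normr_eq0.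
Qed.

(* One step of the recursion that solves V = delta u0 + (psi * V) U' on G;
   the right-hand side only involves values at elements of smaller rank. *)
Definition lower_part (V : G -> 'rV[C]_N) x : 'rV[C]_N :=
  \row_i star_lt (psi i) (fun g => V g 0 i) x.

Definition solve_step (V : G -> 'rV[C]_N) x : 'rV[C]_N :=
  (idf R m id x *: u0 + lower_part V x *m U') *m invmx (resolvent x).

(** A step at x reads values of smaller rank only, so rank + 1 iterations fix the value at x. *)
Definition solution x : 'rV[C]_N := iter (rank m x).+1 solve_step (fun=> 0) x.

Lemma eq_solve_step V V' x :
  (forall q, (rank m q < rank m x)%N -> V q = V' q) ->
  solve_step V x = solve_step V' x.
Proof.
move=> VV; rewrite /solve_step; congr ((_ + _ *m _) *m _).
by apply/rowP => i; rewrite !mxE; apply: eq_star_lt => q /VV ->.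
Qed.

Lemma iter_solve_stable n k x : (rank m x < n)%N -> (rank m x < k)%N ->
  iter n solve_step (fun=> 0) x = iter k solve_step (fun=> 0) x.
Proof.
elim: n k x => [//|n IH] [//|k] x xn xk; rewrite !iterS.
by apply: eq_solve_step => q qx; apply: IH; exact: leq_trans qx _.
Qed.

Lemma solutionP x : solution x = solve_step solution x.
Proof.
rewrite {1}/solution iterS; apply: eq_solve_step => q qx.
exact: iter_solve_stable.
Qed.

Definition conv_row (V : G -> 'rV[C]_N) x : 'rV[C]_N :=
  \row_i star m (psi i) (fun g => V g 0 i) x.

Lemma conv_rowE V x : conv_row V x = V x *m diag_eval x + lower_part V x.
Proof.
apply/rowP => i; rewrite mxE star_split [RHS]mxE /diag_eval mul_mx_diag !mxE.
by rewrite mulrC.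
Qed.

Lemma solve_stepP V x : V x = solve_step V x <->
  V x = idf R m id x *: u0 + conv_row V x *m U'.
Proof.
rewrite conv_rowE mulmxDl -mulmxA /solve_step.
have e : V x *m resolvent x = V x - V x *m (diag_eval x *m U').
  by rewrite /resolvent mulmxBr mulmx1.
split=> h.
  have : V x *m resolvent x = idf R m id x *: u0 + lower_part V x *m U'.
    by rewrite h mulmxKV ?resolvent_unit.
  rewrite e => /eqP; rewrite subr_eq => /eqP {1}->.
  by rewrite -addrA [lower_part _ _ *m _ + _]addrC.
rewrite -[LHS](mulmxK (resolvent_unit x)) e; congr (_ *m _).
by rewrite {1}h addrCA [LHS]addrC addKr.
Qed.

(** The recursion never leaves a lower set, so a solution known only on [F] is already the
    restriction of the global one. *)
Lemma solution_unique (F : {fset G}) V : lower m [set` F] ->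
  (forall x, x \in F -> V x = solve_step V x) ->
  forall x, x \in F -> V x = solution x.
Proof.
move=> lF VF; suff h n x : (rank m x < n)%N -> x \in F -> V x = solution x.
  by move=> x; exact: (h (rank m x).+1).
elim: n x => [//|n IH] x xn xF; rewrite VF // solutionP.
rewrite /solve_step; congr ((_ + _ *m _) *m _); apply/rowP => i; rewrite !mxE.
apply: eq_fsbigr => -[p q] /set_mem[/= pq npq].
have [_ qF] := lower_factors Gsg lF pq xF.
rewrite IH //; rewrite ltnS in xn; apply: leq_trans xn; apply: (rank_lt Gsg pq).
apply/eqP => /= qx; apply: npq.
by rewrite -(lunit_uniq Gsg (_ : m p x = Some x)) ?qx // -{1}qx.
Qed.

End TransferFunction.

(** * Interpolation and the norm bound on G *)

Section Interpolation.
Variables (R : realType) (G : choiceType) (m : pmul G) (Gsg : semigroupoid m).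
Local Notation C := R[i].
Variables (Psi : set {ptws G -> C}) (PsiT : test_functions m Psi).

(* The lurking isometry: the Gram identity of a representation on F provides a
   unitary U taking (delta, psi_i * h_i) to (f, h_i); the transfer function of
   U extends both f and the h_i from F to G. *)
Lemma finrep_extend (F : {fset G}) (lF : lower m [set` F]) (f : F -> C) :
  finrep m Psi f -> exists2 phi : G -> C, fres phi = f &
    forall F' : {fset G}, lower m [set` F'] -> finrep m Psi (fres (F := F') phi).
Proof.
move=> [N [psi [h [P fh]]]].
pose pack (a : C) (b : 'I_N -> C) : 'rV[C]_(1 + N) := row_mx a%:M (\row_i b i).
have gram a b a' b' : pack a b *m adjmx (pack a' b') =
    (a * a'^* + \sum_i b i * (b' i)^*)%:M.
  have adjE n (A : 'rV[C]_n) k : adjmx A k 0 = (A 0 k)^* by rewrite !mxE.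
  apply/matrixP => i j; rewrite !ord1 mxE big_split_ord /= big_ord1 adjE.
  rewrite !row_mxEl !mxE eqxx !mulr1n; congr (_ + _).
  by apply: eq_bigr => k _; rewrite adjE !row_mxEr !mxE.
have pack0 a b : pack a b 0 0 = a.
  transitivity (pack a b 0 (lshift N ord0)).
    by congr (fun_of_matrix _ 0 _); exact: val_inj.
  by rewrite row_mxEl mxE eqxx mulr1n.
pose al (x : F) := pack (idf R m val x) (fun i => mv (tz m (fres (psi i))) (h i) x).
pose be (x : F) := pack (f x) (fun i => h i x).
have ab x y : al x *m adjmx (al y) = be x *m adjmx (be y).
  rewrite !gram; congr (_%:M); have := fh (x, y).
  rewrite -[LHS]/(_ * _ - _ * _) /= => /eqP; rewrite subr_eq => /eqP ->.
  rewrite addrAC addrC; congr (_ + _); rewrite -big_split; apply: eq_bigr => i _ /=.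
  by rewrite -[sterm _ _ _]/(_ * _ - _ * _) /= subrK.
pose nf (g : F -> 'rV[C]_(1 + N)) n : 'rV[C]_(1 + N) :=
  oapp (fun k : 'I_#|{: F}| => g (enum_val k)) 0 (insub n).
have [U UU aU] : exists2 U : 'M[C]_(1 + N), U *m adjmx U = 1%:M &
    forall x, al x *m U = be x.
  have [|U UU nU] := @unitary_extension C (1 + N) #|{: F}| (nf al) (nf be).
    by move=> i j ilt jlt; rewrite /nf !insubT /= ab.
  exists U => // x; have := nU (enum_rank x) (ltn_ord _).
  by rewrite /nf (valK (enum_rank x)) /= enum_rankK.
pose V := solution Gsg psi U.
pose H i g := V g 0 i.
(* The h_i extended by zero; on [F] only their values on [F] enter the recursion, so uniqueness
   identifies them with V there. *)
pose hext g : 'rV[C]_N := \row_i \sum_(y : F) (g == val y)%:R * h i y.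
have hextE i : fres (fun g => hext g 0 i) = h i.
  apply/funext => y; rewrite /fres /= mxE (bigD1 y) //= eqxx mul1r big1 ?addr0 //.
  by move=> z zy; rewrite (inj_eq val_inj) eq_sym (negbTE zy) mul0r.
have pack_mul (a : C) (b : 'rV[C]_N) : pack a (fun i => b 0 i) *m U =
    row_mx (a *: ulsubmx U + b *m dlsubmx U) (a *: ursubmx U + b *m drsubmx U).
  rewrite /pack (_ : \row_i b 0 i = b); last by apply/rowP => i; rewrite mxE.
  by rewrite -{1}[U]submxK mul_row_block !mul_scalar_mx.
have hext_al (x : F) : al x = pack (idf R m id (val x))
    (fun i => conv_row m psi hext (val x) 0 i).
  congr (pack _ _); apply/funext => i; rewrite mxE -[h i]hextE.
  by rewrite (fres_star Gsg lF).
have hext_eq (x : F) : be x = row_mx (f x)%:M (hext (val x)).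
  congr row_mx; apply/rowP => i; rewrite [LHS]mxE.
  by rewrite -[h i](hextE i).
have VF (x : F) : hext (val x) = V (val x).
  apply: (solution_unique lF _ (valP x)) => g gF.
  apply/(solve_stepP Gsg PsiT P UU).
  have := aU [` gF]%fset; rewrite hext_al hext_eq pack_mul /= => /eq_row_mx[_ <-].
  by [].
pose phi g := (pack (idf R m id g) (fun i => conv_row m psi V g 0 i) *m U) 0 0.
have Veq g : pack (idf R m id g) (fun i => conv_row m psi V g 0 i) *m U =
    pack (phi g) (fun i => V g 0 i).
  have Vg := (solve_stepP Gsg PsiT P UU V g).1 (solutionP Gsg psi U g).
  apply/rowP => j; rewrite -[j]splitK; case: (fintype.split j) => k /=.
    rewrite ord1 [RHS]row_mxEl [RHS]mxE eqxx mulr1n /phi.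
    by congr (fun_of_matrix _ 0 _); exact: val_inj.
  by rewrite pack_mul [RHS]row_mxEr mxE row_mxEr -Vg.
exists phi.
  apply/funext => x; rewrite /fres /= /phi.
  have -> : pack (idf R m id (val x)) (fun i => conv_row m psi V (val x) 0 i) = al x.
    rewrite hext_al; congr pack; apply/funext => i; rewrite !mxE.
    have := fres_star Gsg lF (psi i) (fun g => hext g 0 i).
    have := fres_star Gsg lF (psi i) (fun g => V g 0 i).
    rewrite (_ : fres (fun g => V g 0 i) = fres (F := F) (fun g => hext g 0 i)).
      by move=> -> /(congr1 (fun k => k x)).
    by apply/funext => y; rewrite /fres /= VF.
  by rewrite aU; exact: pack0.
move=> F' lF'; exists N, psi, (fun i => fres (H i)); split=> // -[x y].
(* U preserves inner products of rows; on [F'] this is the representation of [1] - phi phi^*. *)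
have UV (v w : 'rV[C]_(1 + N)) : v *m U *m adjmx (w *m U) = v *m adjmx w.
  by rewrite adjmxM mulmxA -(mulmxA v) UU mulmx1.
have := UV (pack (idf R m id (val x)) (fun i => conv_row m psi V (val x) 0 i))
  (pack (idf R m id (val y)) (fun i => conv_row m psi V (val y) 0 i)).
rewrite !Veq !gram => /(congr1 (fun M : 'M[C]_1 => M 0 0)).
rewrite !mxE eqxx !mulr1n => e.
rewrite -[LHS]/(idf R m id (val x) * (idf R m id (val y))^*
  - phi (val x) * (phi (val y))^*).
transitivity (\sum_i V (val x) 0 i * (V (val y) 0 i)^* -
   \sum_i conv_row m psi V (val x) 0 i * (conv_row m psi V (val y) 0 i)^*).
  by apply/eqP; rewrite subr_eq addrAC eq_sym subr_eq [X in X == _]addrC -e addrC.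
rewrite -sumrB; apply: eq_bigr => i _.
have convE z : conv_row m psi V z 0 i = star m (psi i) (H i) z by rewrite mxE.
by rewrite -[RHS]/(rank1 _ _ - rank1 _ _) (fres_star Gsg lF') !convE.
Qed.

Lemma Hinf_bound1 (phi : G -> C) (cPsi : compact Psi) :
  (forall F : {fset G}, lower m [set` F] -> finrep m Psi (fres (F := F) phi)) ->
  Hinf_bound m Psi phi 1.
Proof.
move=> h; split=> // k kK.
have -> : (fun x y => (1 ^+ 2)%:C%C * kone R m x y - outer phi x y) =
    fun x y => kone R m x y - outer phi x y.
  by apply/funext => x; apply/funext => y; rewrite expr1n mul1r.
apply: (pos_kernel_defect Gsg (F0 := fset0)) => F lF _.
have [Gam [pGam fGam]] := dual_of_finrep Gsg cPsi lF (h F lF).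
have := satisfies_kernels_of_dual Gsg PsiT lF pGam fGam.
by move=> /(satisfies_kernelsP Gsg _ _ lF); exact.
Qed.

End Interpolation.

Theorem theorem1p4 (R : realType) (G : choiceType) (m : pmul G)
    (Gsg : semigroupoid m)
    (Psi : set {ptws G -> R[i]}) (PsiT : test_functions m Psi)
    (cPsi : compact Psi)
    (F : {fset G}) (lF : lower m [set` F]) (f : F -> R[i]) :
  [<-> exists phi : G -> R[i],
         [/\ Hinf m Psi phi, Hinf_norm m Psi phi <= 1 & fres phi = f];
       forall k : G -> G -> R[i], K_Psi m Psi k ->
         pos_kernel (kstar (resm m F)
           (fun x y : F => kone R m (val x) (val y) - outer f x y)
           (kres k));
       exists Gam : F -> F -> banach_dual (Cb R Psi), pos_dual_kernel Gam /\
         forall x y : F, kone R m (val x) (val y) - outer f x y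
                         = hatstar m (Cb_eval cPsi) Gam x y].
Proof.
tfae.
- by move=> [phi [hphi nphi <-]]; exact: Hinf_satisfies_kernels.
- move=> fk; apply: dual_of_finrep => //.
  exact: (finrep_of_kernels Gsg PsiT lF cPsi).
move=> [Gam [pGam fGam]].
have fk := satisfies_kernels_of_dual Gsg PsiT lF pGam fGam.
have [phi phif hphi] :=
  finrep_extend Gsg PsiT lF (finrep_of_kernels Gsg PsiT lF cPsi fk).
have b1 := Hinf_bound1 Gsg PsiT cPsi hphi.
exists phi; split=> //; first by exists 1.
by apply: ge_inf => //; exists 0 => c [/ltW].
Qed.
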